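(* Let $n \geq 2$ be an integer and let $q$ be a prime power. Suppose $$q^{1/2} > n\,W(q-1)^2 .$$ Then $q \in Q_n$. Hence, for each integer $n \geq 2$, there exists a constant $C_n > 0$ such that every prime power $q > C_n$ satisfies $q \in Q_n$.
   Context: For a prime power $q$, $\mathbb{F}_q$ is the finite field of order $q$ and $\mathbb{F}_q^*$ its (cyclic) multiplicative group; a generator of $\mathbb{F}_q^*$ is called a primitive element of $\mathbb{F}_q$. For a positive integer $m$, $\omega(m)$ is the number of distinct prime divisors of $m$ and $W(m) = 2^{\omega(m)}$ (the number of square-free divisors of $m$). For a rational function $f(x) \in \mathbb{F}_q(x)$ and $\alpha \in \mathbb{F}_q$, the pair $(\alpha, f(\alpha))$ is a primitive pair in $\mathbb{F}_q$ if $\alpha$ is not a pole of $f$ and both $\alpha$ and $f(\alpha)$ are primitive elements of $\mathbb{F}_q$. Rational functions are written in lowest terms $f = f_1/f_2$ with $f_1, f_2 \in \mathbb{F}_q[x]$ nonzero coprime polynomials, $f_2$ monic, of degrees $n_1$ and $n_2$ respectively; the degree of $f$ is defined to be $n_1 + n_2$. The function $f$ is called exceptional if it is of the form $f(x) = c\,x^j g(x)^d$ for some integer $j$ (positive, negative or zero), some integer $d > 1$ dividing $q-1$, some $c \in \mathbb{F}_q^*$ and some rational function $g(x) \in \mathbb{F}_q(x)$. For each positive integer $n$, $R_n$ (over $\mathbb{F}_q$) is the set of non-exceptional rational functions $f = f_1/f_2$ (with $f_1, f_2 \in \mathbb{F}_q[x]$ nonzero coprime polynomials of degrees $n_1$ and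 $n_2$ respectively, and $f_2$ monic) of degree $n = n_1 + n_2$ with $n_1 \geq n_2$. $Q_n$ is the set of prime powers $q$ such that for each $f \in R_n$ over $\mathbb{F}_q$ there exists $\alpha \in \mathbb{F}_q$ for which $(\alpha, f(\alpha))$ is a primitive pair in $\mathbb{F}_q$. *)

(* Defs.v *)
From mathcomp Require Import all_boot all_order all_algebra all_fingroup all_solvable.
From mathcomp Require Import fraction.
From mathcomp Require Import reals.

Set Implicit Arguments.
Unset Strict Implicit.
Unset Printing Implicit Defensive.

Import Order.TTheory GRing.Theory Num.Theory.
Local Open Scope ring_scope.

Definition prime_power (q : nat) : Prop :=
  exists p k : nat, prime p /\ (0 < k)%N /\ q = (p ^ k)%N.

Definition omega (m : nat) : nat := size (primes m).

Definition W (m : nat) : nat := (2 ^ omega m)%N.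

Definition primitive_element (F : finFieldType) (a : F) : Prop :=
  exists2 u : {unit F}, generator [set: {unit F}] u & FinRing.uval u = a.

(* The field F(x) is [{fraction {poly F}}]. *)
Definition lowest_terms (F : finFieldType) (f : {fraction {poly F}})
    (f1 f2 : {poly F}) : Prop :=
  [/\ f = tofrac f1 / tofrac f2, f1 != 0, f2 \is monic & coprimep f1 f2].

(* [f] has no pole at [a] and takes the value [b] there.  The lowest-terms
   representation is unique, so at most one [b] satisfies this. *)
Definition ratfun_value (F : finFieldType) (f : {fraction {poly F}})
    (a b : F) : Prop :=
  exists f1 f2 : {poly F},
    [/\ lowest_terms f f1 f2, f2.[a] != 0 & b = f1.[a] / f2.[a]].

Definition primitive_pair_at (F : finFieldType) (f : {fraction {poly F}})
    (a : F) : Prop :=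
  exists b : F,
    [/\ ratfun_value f a b, primitive_element a & primitive_element b].

Definition exceptional (F : finFieldType) (f : {fraction {poly F}}) : Prop :=
  exists (j : int) (d : nat) (c : F) (g : {fraction {poly F}}),
    [/\ (1 < d)%N, (d %| #|F| - 1)%N, c != 0 &
        f = tofrac c%:P * tofrac 'X ^ j * g ^+ d].

(* The degree of a nonzero polynomial [p] is [(size p).-1]. *)
Definition in_R (F : finFieldType) (n : nat) (f : {fraction {poly F}}) : Prop :=
  ~ exceptional f /\
  exists f1 f2 : {poly F},
    [/\ lowest_terms f f1 f2,
        ((size f1).-1 + (size f2).-1)%N = n &
        ((size f2).-1 <= (size f1).-1)%N].

(* The field with [q] elements is unique only up to isomorphism, so the
   condition is imposed on every model of it. *)
Definition in_Q (n q : nat) : Prop :=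
  prime_power q /\
  forall F : finFieldType, #|F| = q ->
    forall f : {fraction {poly F}}, in_R n f ->
      exists a : F, primitive_pair_at f a.

(* Main.v *)
Require Import Defs.
From mathcomp Require Import all_boot all_order all_algebra all_fingroup all_solvable.
From mathcomp Require Import fraction.
From mathcomp Require Import reals.
From mathcomp Require Import all_field polyXY.
From mathcomp Require Import zify ring.

(** Write q = #|F| and N = q - 1, and let chi be a generator of the group of
    multiplicative characters of F.  The indicator of the primitive elements
    is a combination of powers of chi with a constant term theta and
    non-constant terms of total weight at most (W(N) - 1) theta
    (primitive_expansion).  Expanding the indicators at x and at f(x), and
    summing over the x that are neither 0 nor zeros or poles of f, writes the
    number of primitive pairs as theta^2 times the number of such x plus sums
    of chi(x^a f(x)^b) of total weight at most (W(N)^2 - 1) theta^2.  Each of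
    these sums is at most n sqrt q, so the hypothesis makes the main term win
    (primitive_pair_exists).  The constant C_n exists because 2^omega(m) grows
    more slowly than every power of m (expn_omega_le).

    If N divides b the bound is elementary.  Otherwise it is the Weil bound
    n sqrt q, with exactly this constant, for the sum of chi(H(x)), where H is
    x^a f1^b f2^(-b) modulo N-th powers.  The Weil bound applies because H is
    not an N-th power, which is where non-exceptionality enters
    (twisted_not_power).  It is proved here (weil_bound) in two stages.

    First stage: a bound C sqrt Q with an unspecified C, over the fields with
    Q = q^(2k) elements, k large (sqrt_norm_sums).  This is Stepanov's method.
    Reduce to H = h^u with u dividing N and d = N / u as small as possible.
    For each d-th root of unity c, a nonzero polynomial of controlled degree
    is made to vanish to high order at all x with h(x)^((Q-1)/d) = c, so there
    are at most Q/d + O(sqrt Q) of these (stepanov_count).  The counts for the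
    d values of c add up to about Q, so each of them is Q/d + O(sqrt Q) from
    both sides and the character sum cancels.  The auxiliary polynomial is a
    combination of products X^i h^(j(Q-1)/d) X^(lQ) with j < d and i less than
    about Q/d; these are linearly independent because T^d - h(Y)/h(X) is
    irreducible over K(X,Y) (stepanov_nonvanishing), which holds by minimality
    of d.

    Second stage: removal of C.  The values chi(Res(g, H)), summed over the
    monic g of degree m, are the coefficients of an L-function.  They vanish
    for m > n, since g |-> chi(Res(g, H)) is a non-trivial character modulo a
    polynomial of degree n + 1 (lcoef_eq0, norm_char_nontrivial); so the
    L-function is a product of at most n factors 1 - w X.  Sorting the monic
    polynomials by the Frobenius orbits of their roots identifies its
    logarithmic derivative: the sum over the field with q^k elements is minus
    the k-th power sum of the w (lcoef_newton, newton_identity).  By the first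
    stage the power sums of the w^2 are O(q^k), which forces |w| <= sqrt q
    whatever the constant (power_sums_bound).  The sum over F itself is, up to
    a sign, the coefficient of X, that is minus the sum of the w. *)

Set Implicit Arguments.
Unset Strict Implicit.
Unset Printing Implicit Defensive.

Import Order.TTheory GRing.Theory Num.Theory.
Local Open Scope ring_scope.

(** * Resultants, Kummer factors and Stepanov's linear independence *)

(** The size of [companionmx p] is [(size p).-1]; naming it [e] gives access to
    the ring structure of square matrices when [e] is a successor. *)
Lemma monic_char_polyP (R : comNzRingType) (p : {poly R}) e :
  p \is monic -> size p = e.+1 -> exists A : 'M[R]_e, char_poly A = p.
Proof.
move=> mp sp; have E : (size p).-1 = e by rewrite sp.
by case: e / E {sp}; exists (companionmx p); apply: companionmxK.
Qed.

(** If A is a matrix with characteristic polynomial p, up to the leading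
    coefficient, then p(A) = 0, so a A^d = b; the determinant of A is the
    required c.  This takes the place of multiplying the roots of p in an
    extension. *)
Lemma kummer_factor (K : fieldType) (a b : K) d (p : {poly K}) :
  a != 0 -> (1 < size p)%N -> p %| a *: 'X^d - b%:P ->
  exists c, a ^+ (size p).-1 * c ^+ d = b ^+ (size p).-1.
Proof.
move=> a0 sp dp.
have p0 : p != 0 by rewrite -size_poly_gt0; apply: ltnW.
have l0 : lead_coef p != 0 by rewrite lead_coef_eq0.
pose p1 := (lead_coef p)^-1 *: p.
have mp1 : p1 \is monic by rewrite monicE lead_coefZ mulVf.
have l1 : (lead_coef p)^-1 != 0 by rewrite invr_eq0.
(* A matrix of size e.+1 is needed for [horner_mx]. *)
case E : (size p) => [|[|e]]; first 1 [by rewrite E in sp|by rewrite E in sp].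
have sp1 : size p1 = e.+2 by rewrite size_scale.
have [A hA] := monic_char_polyP mp1 sp1.
have : p1 %| a *: 'X^d - b%:P by rewrite dvdpZl.
case/dvdpP => u /(congr1 (horner_mx A)).
rewrite rmorphM /= -hA Cayley_Hamilton mulr0 rmorphB /= linearZ /= rmorphXn /=.
rewrite horner_mx_X horner_mx_C => /eqP; rewrite subr_eq0 => /eqP /(congr1 determinant).
have detX n : \det (A ^+ n) = (\det A) ^+ n.
  by elim: n => [|n IH]; rewrite ?expr0 ?det1 // !exprS detM IH.
by rewrite detZ det_scalar detX => <-; exists (\det A).
Qed.

Section InnerDegree.
Variable R : idomainType.
Implicit Types p q : {poly {poly R}}.

(** A polynomial in Y over R[X], here an element of [{poly {poly R}}], has
    degree at most n in X. *)
Definition inner_deg (n : nat) (p : {poly {poly R}}) : Prop :=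
  forall i, (size (p`_i)%R <= n.+1)%N.

Lemma inner_deg0 n : inner_deg n 0.
Proof. by move=> i; rewrite coef0 size_poly0. Qed.

Lemma inner_deg1 n : inner_deg n 1.
Proof. by move=> i; rewrite coef1; case: eqP; rewrite ?size_poly1 ?size_poly0. Qed.

Lemma inner_degN n p : inner_deg n p -> inner_deg n (- p).
Proof. by move=> h i; rewrite coefN size_polyN. Qed.

Lemma inner_degD n p q : inner_deg n p -> inner_deg n q -> inner_deg n (p + q).
Proof.
move=> hp hq i; rewrite coefD; apply: leq_trans (size_polyD _ _) _.
by rewrite geq_max hp hq.
Qed.

Lemma inner_deg_sum (I : Type) (r : seq I) (P : pred I) n (f : I -> {poly {poly R}}) :
  (forall i, P i -> inner_deg n (f i)) -> inner_deg n (\sum_(i <- r | P i) f i).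
Proof. by move=> h; elim/big_ind: _ => //; [apply: inner_deg0|move=> *; apply: inner_degD]. Qed.

Lemma inner_degM m n p q : inner_deg m p -> inner_deg n q -> inner_deg (m + n) (p * q).
Proof.
move=> hp hq i; rewrite coefM; apply: leq_trans (size_sum _ _ _) _.
apply/bigmax_leqP=> j _; apply: leq_trans (size_polyMleq _ _) _.
by have := hp j; have := hq (i - j)%N; lia.
Qed.

Lemma inner_deg_prod (I : Type) (r : seq I) (P : pred I) (n : I -> nat)
    (f : I -> {poly {poly R}}) :
  (forall i, P i -> inner_deg (n i) (f i)) ->
  inner_deg (\sum_(i <- r | P i) n i) (\prod_(i <- r | P i) f i).
Proof.
by move=> h; elim/big_ind2: _ => //; [apply: inner_deg1|move=> *; apply: inner_degM].
Qed.

Lemma inner_deg_det m (A : 'M[{poly {poly R}}]_m) (b : 'I_m -> nat) :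
  (forall i j, inner_deg (b i) (A i j)) -> inner_deg (\sum_i b i) (\det A).
Proof.
move=> h; apply: inner_deg_sum => s _; rewrite mulr_sign; have := inner_deg_prod.
by case: (odd_perm s) => hh; [apply: inner_degN|]; apply: hh.
Qed.

Lemma inner_deg_resultant (p q : {poly {poly {poly R}}}) m n :
  (forall i, inner_deg m p`_i) ->
  (forall i, inner_deg n q`_i) ->
  inner_deg ((size q).-1 * m + (size p).-1 * n) (resultant p q).
Proof.
move=> hp hq.
pose b (i : 'I_((size q).-1 + (size p).-1)) := if split i is inl _ then m else n.
have <- : (\sum_i b i = (size q).-1 * m + (size p).-1 * n)%N.
  rewrite big_split_ord /=; congr (_ + _)%N.
    rewrite (eq_bigr (fun=> m)) => [|i _]; last by rewrite /b (unsplitK (inl _ _)).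
    by rewrite sum_nat_const card_ord.
  rewrite (eq_bigr (fun=> n)) => [|i _]; last by rewrite /b (unsplitK (inr _ _)).
  by rewrite sum_nat_const card_ord.
apply: inner_deg_det => i j; rewrite Sylvester_mxE /b.
by case: (split i) => k; case: (_ <= _)%N; rewrite ?mulr1n ?mulr0n //; apply: inner_deg0.
Qed.

(** The substitution Y = X^Q makes the coefficients of p digits in base X^Q, so
    they cannot interfere. *)
Lemma horner_expX_inj Q (p : {poly {poly R}}) :
  (forall i, (size (p`_i)%R <= Q)%N) -> p.['X^Q] = 0 -> p = 0.
Proof.
elim/poly_ind: p => [//|p c IH] hs.
have hc : (size c <= Q)%N by have := hs 0%N; rewrite coefD coefMX coefC eqxx add0r.
have hp i : (size (p`_i)%R <= Q)%N.
  by have := hs i.+1; rewrite coefD coefMX coefC addr0.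
rewrite hornerMXaddC => e; have c0 : c = 0.
  apply/polyP=> i; rewrite coef0; case: (ltnP i Q) => li; last first.
    by rewrite nth_default // (leq_trans hc).
  by have /(congr1 (fun q : {poly R} => q`_i)) := e; rewrite coefD coefMXn li add0r coef0.
move: e; rewrite c0 addr0 => /eqP; rewrite mulf_eq0.
rewrite (negPf (monic_neq0 (monicXn _ _))) orbF => /eqP /(IH hp) ->.
by rewrite mul0r addr0.
Qed.

End InnerDegree.

Lemma fracP (R : idomainType) (x : {fraction R}) :
  exists a b : R, b != 0 /\ x = tofrac a / tofrac b.
Proof.
elim/quotW: x => y; exists \n_y, \d_y; split; first exact: denom_ratioP.
unlock FracField.tofrac.
rewrite -[X in _ * X]FracField.pi_inv -[RHS]FracField.pi_mul.
apply/eqmodP; rewrite /= FracField.equivfE /FracField.mulf /FracField.invf /=.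
by rewrite !numden_Ratio ?oner_neq0 ?mulr1 ?mul1r ?denom_ratioP // mulrC.
Qed.

Lemma mup_map (K L : fieldType) (f : {rmorphism K -> L}) (p : {poly K}) x :
  p != 0 -> mup (f x) (map_poly f p) = mup x p.
Proof.
move=> p0; have fp0 : map_poly f p != 0 by rewrite map_poly_eq0.
have E n : (n <= mup (f x) (map_poly f p))%N = (n <= mup x p)%N.
  by rewrite !mup_geq // -(dvdp_map f) rmorphXn rmorphB /= map_polyX map_polyC.
by apply/eqP; rewrite eqn_leq -E leqnn E leqnn.
Qed.

Lemma mup_expn (K : fieldType) (x : K) p n : p != 0 -> mup x (p ^+ n) = (n * mup x p)%N.
Proof.
move=> p0; elim: n => [|n IH]; first by rewrite expr0 mupNroot ?root1.
by rewrite exprS mupM ?expf_neq0 // IH mulSn.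
Qed.

Section Nonvanishing.
Variables (K : fieldType) (h : {poly K}) (d M Q D s : nat).
Hypotheses (h0 : h != 0) (hQ : h ^+ Q = h \Po 'X^Q) (QE : Q = (M * d).+1).
Hypothesis dD : (d * D + d * s < Q)%N.
Hypothesis sh : (size h <= s.+1)%N.
Hypothesis irr : forall e, (0 < e < d)%N -> exists rho, ~~ (d %| e * mup rho h)%N.

(** With M = (Q-1)/d, the relation says that T = h^M is a root of
    U = sum k_j(X, Y) T^j once Y = X^Q.  It is also a root of
    V = h(X) T^d - h(Y), because h(X^Q) = h^Q.  Hence the resultant of U and V
    in T vanishes at Y = X^Q; its degree in X is less than Q, so it is zero.  A
    common factor of degree e, 0 < e < d, over K(X, Y) makes h(Y)^e a d-th power
    up to a factor that depends on X only, so that d divides e times every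
    multiplicity of h, against [irr]. *)
Lemma stepanov_nonvanishing (k : 'I_d -> {poly {poly K}}) :
  (forall j, inner_deg D (k j)) ->
  \sum_j (k j).['X^Q] * h ^+ (M * j) = 0 -> forall j, k j = 0.
Proof.
move=> hk rel; pose U : {poly {poly {poly K}}} := \sum_(j < d) k j *: 'X^j.
pose V : {poly {poly {poly K}}} := h%:P *: 'X^d - (h^:P)%:P.
have Uj j : U`_j = if insub j is Some i then k i else 0.
  rewrite coef_sum; case: insubP => [i ltj ij|]; last first.
    rewrite -leqNgt => ledj; apply: big1 => i _; rewrite coefZ coefXn.
    by rewrite gtn_eqF ?mulr0 // (leq_trans _ ledj).
  rewrite (bigD1 i) //= coefZ coefXn -ij eqxx mulr1 big1 ?addr0 // => l li.
  by rewrite coefZ coefXn eq_sym (negPf (li : val l != val i)) mulr0.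
have [U0|U0] := eqVneq U 0.
  by move=> j; have := Uj j; rewrite U0 coef0 valK.
have d0 : (0 < d)%N.
  rewrite lt0n; apply: contraNneq U0 => d00; rewrite /U; apply/eqP/big1 => -[j jd].
  by exfalso; move: jd; rewrite d00.
have sU : (size U <= d)%N.
  apply/leq_sizeP => j; rewrite Uj; case: insubP => // i.
  by rewrite ltnNge => /negPf->.
have hP0 : h%:P != 0 by rewrite polyC_eq0.
have sV : size V = d.+1.
  rewrite size_polyDl ?size_scale ?size_polyXn // size_polyN size_polyC.
  by case: (_ != 0).
have V0 : V != 0 by rewrite -size_poly_gt0 sV.
have lV : lead_coef V = h%:P.
  rewrite lead_coefE sV coefB coefZ coefXn eqxx mulr1 coefC.
  by rewrite gtn_eqF // subr0.
(* [resultant_in_ideal] needs U of positive degree in T; if U is a constant,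
   the relation itself is the evaluation of its only coefficient. *)
have [sU1|sU1] := leqP (size U) 1.
  move: rel sU1 => rel /size1_polyC UE.
  have kj (j : 'I_d) : (0 < j)%N -> k j = 0.
    move=> j0; have := Uj j; rewrite UE coefC gtn_eqF // valK => <- //.
  have := rel; rewrite (bigD1 (Ordinal d0)) //= muln0 mulr1 big1 ?addr0 => [|j jn].
    move=> /horner_expX_inj k0 j; have [->|] := eqVneq j (Ordinal d0).
      apply: k0 => i; apply: leq_trans (hk _ _) _; move: dD; nia.
    by move=> jn; apply: kj; rewrite lt0n.
  by rewrite kj ?horner0 ?mul0r // lt0n.
have res0 : resultant U V = 0.
  apply: (@horner_expX_inj _ Q).
    move=> i; have := @inner_deg_resultant _ U V D s.
    move=> /(_ _ _ i) hh; apply: leq_trans (hh _ _) _ => {hh} [j|j|].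
    - by rewrite Uj; case: insubP => // *; apply: inner_deg0.
    - rewrite coefB coefZ coefXn; apply: inner_degD.
        case: (_ == _); rewrite ?mulr0 ?mulr1; last exact: inner_deg0.
        by move=> l; rewrite coefC; case: eqP; rewrite ?size_poly0.
      apply: inner_degN; rewrite coefC; case: (_ == _); last exact: inner_deg0.
      by move=> l; rewrite coef_map; apply: leq_trans (size_polyC_leq1 _) _.
    rewrite sV /=; move: dD sU sU1; case: (size U) => // u; nia.
  have [| |uv _] := @resultant_in_ideal _ U V; rewrite ?sV //.
  move/(congr1 (fun p : {poly {poly {poly K}}} => (p.[(h ^+ M)%:P]).['X^Q])).
  rewrite hornerC 2!hornerD 4!hornerM => ->.
  have -> : (U.[(h ^+ M)%:P]).['X^Q] = 0.
    rewrite -rel !horner_sum; apply: eq_bigr => j _.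
    by rewrite hornerZ hornerXn hornerM horner_exp hornerC exprM.
  have -> : (V.[(h ^+ M)%:P]).['X^Q] = 0.
    rewrite hornerD hornerN hornerC hornerZ hornerXn.
    rewrite hornerD hornerN hornerM hornerC horner_exp hornerC.
    by rewrite -exprM -exprS -QE hQ /comp_poly subrr.
  by rewrite !mulr0 addr0.
(* The common factor is taken over the fraction field of K[X][Y]. *)
pose f := @tofrac {poly {poly K}}.
exfalso.
have finj : injective f by move=> x y /eqP; rewrite tofrac_eq => /eqP.
have mf0 (p : {poly {poly {poly K}}}) : p != 0 -> f (lead_coef p) != 0.
  by rewrite -lead_coef_eq0 -(tofrac_eq0 (lead_coef p)).
have : resultant (map_poly f U) (map_poly f V) == 0.
  by rewrite -map_resultant ?mf0 // res0 rmorph0.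
rewrite resultant_eq0; set p := gcdp _ _ => sp.
have pU : p %| map_poly f U by apply: dvdp_gcdl.
have pV : p %| map_poly f V by apply: dvdp_gcdr.
have sfU : size (map_poly f U) = size U by apply: size_map_inj_poly => //; rewrite rmorph0.
have spU : (size p <= size U)%N.
  by rewrite -sfU dvdp_leq // -size_poly_gt0 sfU; apply: ltnW.
have [||c] := @kummer_factor _ (f h%:P) (f h^:P) d p _ sp.
- by rewrite tofrac_eq0.
- by move: pV; rewrite rmorphB /= map_polyZ /= map_polyXn map_polyC.
set e := (size p).-1 => ce.
have ed : (0 < e < d)%N by move: sp spU sU; rewrite /e; lia.
have [rho /negP[]] := irr ed.
have [c1 [c2 [c20 cE]]] := fracP c.
have e1 : h%:P ^+ e * c1 ^+ d = (h^:P) ^+ e * c2 ^+ d.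
  have fc2 : f c2 ^+ d != 0 by rewrite expf_neq0 // tofrac_eq0.
  apply: finj; rewrite /f !tofracM !tofracXn -/f -ce cE expr_div_n -!mulrA; congr (_ * _).
  by rewrite mulVf // mulr1.
(* Multiplicities of Y = rho, over the field K(X). *)
pose g : {rmorphism {poly K} -> {fraction {poly K}}} := @tofrac {poly K}.
have ginj : injective g by move=> x y /eqP; rewrite tofrac_eq => /eqP.
have g0 (p0 : {poly {poly K}}) : p0 != 0 -> map_poly g p0 != 0.
  by move=> q0; rewrite map_poly_eq0_id0 // (tofrac_eq0 (lead_coef p0)) lead_coef_eq0.
have hh0 : h^:P != 0 by rewrite map_poly_eq0_id0 // polyC_eq0 lead_coef_eq0.
have c10 : c1 != 0.
  apply: contraNneq (expf_neq0 e hh0) => c10.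
  by have /esym/eqP := e1; rewrite c10 expr0n gtn_eqF // mulr0 mulf_eq0
    [in X in _ || X -> _]expf_eq0 (negPf c20) andbF orbF.
have := congr1 (fun q => mup (g rho%:P) (map_poly g q)) e1.
rewrite !rmorphM !rmorphXn /= !mupM ?expf_neq0 ?g0 // !mup_expn ?g0 //.
have -> : map_poly g h^:P = map_poly (g \o polyC) h by rewrite -map_poly_comp.
rewrite (@mup_map _ _ (g \o polyC)) // map_polyC.
rewrite mupNroot ?muln0 ?add0n => [E|]; last first.
  by rewrite rootC (tofrac_eq0 h).
have := dvdn_mulr (mup (g rho%:P) (map_poly g c1)) (dvdnn d).
by rewrite E dvdn_addl //; apply: dvdn_mulr.
Qed.
End Nonvanishing.

(** * Stepanov's auxiliary polynomial *)

Lemma underdetermined_system (K : fieldType) (I J : finType) (a : I -> J -> K) :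
  (#|J| < #|I|)%N ->
  exists v : I -> K, (exists i, v i != 0) /\ forall j, \sum_i v i * a i j = 0.
Proof.
move=> ltJI; pose A : 'M[K]_(#|I|, #|J|) := \matrix_(i, j) a (enum_val i) (enum_val j).
have k0 : kermx A != 0.
  by rewrite -mxrank_eq0 mxrank_ker -lt0n subn_gt0 (leq_ltn_trans (rank_leq_col A)).
have /rowV0Pn [u /sub_kermxP uA u0] := k0.
exists (fun i => u 0 (enum_rank i)); split.
  have [i ui] : exists i, u 0 i != 0.
    apply/existsP; apply: contraNT u0; rewrite negb_exists => /forallP hu.
    by apply/eqP/rowP=> i; rewrite mxE; apply/eqP; rewrite -[_ == _]negbK hu.
  by exists (enum_val i); rewrite enum_valK.
move=> j; have /rowP/(_ (enum_rank j)) := uA; rewrite !mxE; apply: etrans.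
rewrite [RHS](reindex (@enum_rank I)) /=; last exact/onW_bij/enum_rank_bij.
by apply: eq_bigr => i _; rewrite mxE !enum_rankK.
Qed.

Section Taylor.
Variable K : fieldType.
Implicit Types p q : {poly K}.

Lemma poly_XaYM p q : poly_XaY (p * q) = poly_XaY p * poly_XaY q.
Proof. by rewrite /poly_XaY rmorphM /= comp_polyM. Qed.

Lemma poly_XaYX p n : poly_XaY (p ^+ n) = poly_XaY p ^+ n.
Proof. by rewrite /poly_XaY rmorphXn /= rmorphXn. Qed.

Lemma coef_poly_XaY_comb (I : finType) (v : I -> K) (r : I -> {poly K}) t :
  (poly_XaY (\sum_x v x *: r x))`_t = \sum_x v x *: (poly_XaY (r x))`_t.
Proof.
rewrite /poly_XaY rmorph_sum /= raddf_sum /= coef_sum; apply: eq_bigr => x _.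
by rewrite -mul_polyC rmorphM /= map_polyC comp_polyM comp_polyC coefCM mul_polyC.
Qed.

(** [poly_XaY p] is p(X + T) as a polynomial in T over K[X]; its coefficients
    are the Hasse derivatives of p, which detect vanishing to any order in any
    characteristic. *)
Lemma poly_XaY_vanish p x l :
  (forall t, (t < l)%N -> ((poly_XaY p)`_t).[x] = 0) -> ('X - x%:P) ^+ l %| p.
Proof.
move=> hv; pose q := p \Po ('X + x%:P).
have qE : q = map_poly (horner_eval x) (poly_XaY p).
  rewrite /q /poly_XaY map_comp_poly -map_poly_comp rmorphD /= map_polyX map_polyC.
  rewrite /= /horner_eval hornerX; congr (_ \Po _); apply/polyP=> i.
  by rewrite coef_map_id0 /= /horner_eval hornerC.
have : q = drop_poly l q * 'X^l.
  rewrite -{1}(poly_take_drop l q) [X in X + _ = _](_ : _ = 0) ?add0r //.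
  apply/polyP=> t; rewrite coef_take_poly coef0; case: ifP => // /hv.
  by rewrite qE coef_map.
move/(congr1 (fun r => r \Po ('X - x%:P))); rewrite comp_polyM comp_Xn_poly.
rewrite /q -comp_polyA comp_polyD comp_polyX comp_polyC subrK comp_polyXr => ->.
exact: dvdp_mull.
Qed.

(** For Q a power of the characteristic and c = X^Q, the polynomial 'X^Q + c%:P
    is [poly_XaY 'X^Q]: powers of X^Q behave as constants for the Hasse
    derivatives of order less than Q. *)
Lemma coef_mul_Frobenius_low (R : comNzRingType) (P : {poly R}) c Q i t : (t < Q)%N ->
  (P * ('X^Q + c%:P) ^+ i)`_t = P`_t * c ^+ i.
Proof.
move=> tQ; elim: i => [|i IH]; first by rewrite !expr0 !mulr1.
by rewrite exprSr mulrA mulrDr coefD coefMXn tQ add0r coefMC IH exprSr mulrA.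
Qed.

Variables (h : {poly K}) (s : nat).

(** The Hasse derivative of order t of h^e r, with r of degree b, is h^(e-t)
    times a polynomial of degree at most b + t s.  The factor h^t on the left
    keeps the exponents natural numbers when t > e. *)
Definition taylor_bounded e b p := exists w : nat -> {poly K}, forall t,
  h ^+ t * (poly_XaY p)`_t = h ^+ e * w t /\ (size (w t) <= (b + t * s).+1)%N.

Lemma taylor_boundedM e1 e2 b1 b2 p1 p2 :
  taylor_bounded e1 b1 p1 -> taylor_bounded e2 b2 p2 ->
  taylor_bounded (e1 + e2) (b1 + b2) (p1 * p2).
Proof.
move=> [w1 h1] [w2 h2].
exists (fun t => \sum_(u < t.+1) w1 u * w2 (t - u)%N) => t; split.
  rewrite poly_XaYM coefM !mulr_sumr; apply: eq_bigr => u _.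
  have [e1u _] := h1 u; have [e2u _] := h2 (t - u)%N.
  have ut : (u <= t)%N by rewrite -ltnS.
  by rewrite exprD mulrACA -e1u -e2u mulrACA -exprD subnKC.
apply: leq_trans (size_sum _ _ _) _; apply/bigmax_leqP=> u _.
apply: leq_trans (size_polyMleq _ _) _.
have [_ s1] := h1 u; have [_ s2] := h2 (t - u)%N.
have ut : (u <= t)%N by rewrite -ltnS.
have : (t * s = u * s + (t - u) * s)%N by rewrite -mulnDl subnKC.
by move: s1 s2; lia.
Qed.

Lemma taylor_bounded1 : taylor_bounded 0 0 1.
Proof.
exists (fun t => (t == 0%N)%:R) => t.
rewrite /poly_XaY rmorph1 rmorph1 coef1; case: t => [|t] /=.
  by rewrite !expr0 !mulr1 size_poly1.
by rewrite !mulr0 size_poly0.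
Qed.

Lemma size_poly_XaY_coef p t : (size ((poly_XaY p)`_t)%R <= size p)%N.
Proof.
apply: leq_trans (max_size_coefXY _ _) _.
by rewrite sizeYE swapXY_poly_XaY size_poly_XaY.
Qed.

Lemma coef0_poly_XaY p : (poly_XaY p)`_0 = p.
Proof. by rewrite -horner_coef0 horner_poly_XaY add0r comp_polyXr. Qed.

Hypothesis sh : (size h <= s.+1)%N.

Lemma size_pow_le t : (size (h ^+ t) <= (t * s).+1)%N.
Proof.
apply: leq_trans (size_poly_exp_leq _ _) _; rewrite ltnS mulnC leq_mul2l.
by apply/orP; right; move: sh; lia.
Qed.

Lemma taylor_bounded_poly p : taylor_bounded 0 (size p).-1 p.
Proof.
have [->|p0] := eqVneq p 0.
  by exists (fun=> 0) => t; rewrite poly_XaY0 coef0 !mulr0 size_poly0.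
exists (fun t => h ^+ t * (poly_XaY p)`_t) => t; rewrite expr0 mul1r; split=> //.
apply: leq_trans (size_polyMleq _ _) _.
have s1 := size_poly_XaY_coef p t; have s2 := size_pow_le t.
have p1 : (0 < size p)%N by rewrite size_poly_gt0.
apply: leq_trans (_ : ((t * s).+1 + size p).-1 <= _)%N; last by lia.
by rewrite -!subn1 leq_sub2r // leq_add.
Qed.

Lemma taylor_bounded_base : taylor_bounded 1 0 h.
Proof.
exists (fun t => if t is t'.+1 then h ^+ t' * (poly_XaY h)`_t else 1) => -[|t].
  by rewrite coef0_poly_XaY expr0 mulr1 mul1r expr1 size_poly1.
rewrite exprS mulrA expr1; split=> //.
apply: leq_trans (size_polyMleq _ _) _.
have s1 := size_poly_XaY_coef h t.+1; have s2 := size_pow_le t.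
apply: (@leq_trans ((t * s).+1 + size h).-1); first by rewrite -!subn1 leq_sub2r // leq_add.
by move: sh; rewrite mulSn; lia.
Qed.

Lemma taylor_bounded_pow e : taylor_bounded e 0 (h ^+ e).
Proof.
elim: e => [|e IH]; first by rewrite expr0; exact: taylor_bounded1.
by rewrite exprS; exact: taylor_boundedM taylor_bounded_base IH.
Qed.

End Taylor.

Lemma exprD_pchar (R : comNzRingType) p a (x y : R) : p \in [pchar R] ->
  (x + y) ^+ (p ^ a) = x ^+ (p ^ a) + y ^+ (p ^ a).
Proof.
move=> cp; rewrite exprDn_pchar // pnatX (eq_pnat _ (pcharf_eq cp)).
by rewrite pnat_id ?(pcharf_prime cp).
Qed.

(** Powers of distinct linear factors are coprime. *)
Lemma dvdp_prod_uniq (K : fieldType) (s : seq K) l (p : {poly K}) : uniq s ->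
  (forall x, x \in s -> ('X - x%:P) ^+ l %| p) -> \prod_(x <- s) ('X - x%:P) ^+ l %| p.
Proof.
elim: s => [|x s IH] /=; first by rewrite big_nil dvd1p.
case/andP=> xs us hs; rewrite big_cons Gauss_dvdp ?hs ?inE ?eqxx //=.
  by apply: IH => // y ys; apply: hs; rewrite inE ys orbT.
rewrite big_seq; elim/big_ind: _ => [|u v|y ys].
- exact: coprimep1.
- by rewrite coprimepMr => -> ->.
apply: coprimep_expl; apply: coprimep_expr.
rewrite coprimep_XsubC root_XsubC.
by apply: contraNneq xs => <-.
Qed.

Section Stepanov.
Variables (K : fieldType) (h : {poly K}) (p a d M m s : nat) (c : K) (Z : seq K).
Let Q := (m * m)%N.
Let B := (2 * d * (1 + d * s))%N.
Hypotheses (cp : p \in [pchar K]) (Qp : Q = (p ^ a)%N) (QE : Q = (M * d).+1).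
Hypotheses (h0 : h != 0) (sh : (size h <= s.+1)%N) (hQ : h ^+ Q = h \Po 'X^Q).
Hypotheses (d0 : (0 < d)%N) (m_large : (2 * d + 2 + 2 * d * s < m)%N).
Hypothesis irr : forall e, (0 < e < d)%N -> exists rho, ~~ (d %| e * mup rho h)%N.
Hypotheses (c0 : c != 0) (uZ : uniq Z).
Hypothesis ZP : forall x, x \in Z -> x ^+ Q = x /\ h.[x] ^+ M = c.

(* The count of Z is about A Q / l = Q / d + O(m); B makes A exceed l / d by just
   enough for the unknowns to outnumber the conditions. *)
Let A := (m + B)%N.
Let D := (M - s)%N.
Let l := (d * m)%N.
Let E := (A + D + l * s)%N.

Let sM : (s < M)%N.
Proof.
have : (d * s < d * M)%N; last by rewrite ltn_pmul2l.
by move: QE m_large; rewrite /Q; nia.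
Qed.

Let count_ineq : (l * E < d * A * D)%N.
Proof.
have h1 : (d * D + d * s = Q - 1)%N.
  by rewrite QE subn1 /= /D -mulnDr subnK ?(ltnW sM) // mulnC.
have h2 : (Q * (1 + d * s) + m * B < B * D)%N.
  rewrite /B; have -> : (2 * d * (1 + d * s) * D = 2 * (1 + d * s) * (d * D))%N by ring.
  have -> : (d * D = Q - 1 - d * s)%N by lia.
  have -> : (Q * (1 + d * s) + m * (2 * d * (1 + d * s)) = (1 + d * s) * (Q + 2 * d * m))%N by ring.
  rewrite [(2 * (1 + _))%N]mulnC -[ltnRHS]mulnA ltn_pmul2l //.
  by move: m_large; rewrite /Q; nia.
rewrite /E /A /l -[ltnLHS]mulnA -[ltnRHS]mulnA ltn_pmul2l //.
have -> : (m * (m + B + D + d * m * s) = m * D + (Q * (1 + d * s) + m * B))%N.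
  by rewrite /Q; ring.
by rewrite mulnDl ltn_add2l.
Qed.

(** The combination R of the X^del h^(M j) X^(i Q) with j < d, i < A and del < D
    has d A D free coefficients.  At a point x of Z, x^Q = x and h(x)^M = c turn
    h(x)^t times the Hasse derivative of R of order t < l into the value at x of
    one polynomial of size at most E, the same for all x.  Making these polynomials
    zero costs l E linear conditions, fewer than d A D by [count_ineq]; then R
    vanishes to order l on Z, and l * size Z is less than the size of R. *)
Lemma stepanov_count : (d * size Z <= Q + m * (1 + s + B))%N.
Proof.
pose I : finType := ('I_d * 'I_A * 'I_D)%type.
pose b (x : I) : {poly K} := 'X^(x.2) * h ^+ (M * x.1.1).
have /fin_all_exists [w wP] (x : I) : taylor_bounded h s (M * x.1.1) x.2 (b x).
  have := taylor_boundedM (taylor_bounded_poly sh 'X^(x.2))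
    (taylor_bounded_pow sh (M * x.1.1)).
  by rewrite size_polyXn add0n addn0.
pose P t (v : I -> K) : {poly K} :=
  \sum_x v x *: (c ^+ x.1.1 *: ('X^(x.1.2) * w x t)).
have cardI : (#|{: 'I_l * 'I_E}| < #|I|)%N.
  by rewrite !card_prod !card_ord count_ineq.
have [v [[x0 vx0] vP]] := underdetermined_system
  (fun (x : I) (k : 'I_l * 'I_E) => (c ^+ x.1.1 *: ('X^(x.1.2) * w x k.1))`_k.2) cardI.
have P0 t : (t < l)%N -> P t v = 0.
  move=> tl; apply/polyP=> k; rewrite coef0; have [kE|Ek] := ltnP k E.
    rewrite -[RHS](vP (Ordinal tl, Ordinal kE)) /P coef_sum.
    by apply: eq_bigr => x _; rewrite coefZ.
  apply: nth_default; apply: leq_trans _ Ek; apply: leq_trans (size_sum _ _ _) _.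
  apply/bigmax_leqP=> x _; do 2 apply: leq_trans (size_scale_leq _ _) _.
  apply: leq_trans (size_polyMleq _ _) _; rewrite size_polyXn /=.
  have [_ sw] := wP x t; apply: leq_trans (leq_add (leqnn _) sw) _.
  case: x {sw} => [[j i] e] /=.
  have xA := ltn_ord i; have xD := ltn_ord e.
  have : (t * s <= l * s)%N by rewrite leq_mul2r ltnW ?orbT.
  by rewrite /E; lia.
pose r (x : I) := b x * 'X^(x.1.2 * Q).
pose R := \sum_x v x *: r x.
have tayQ : poly_XaY ('X^Q : {poly K}) = 'X^Q + ('X^Q)%:P.
  rewrite poly_XaYX /poly_XaY map_polyX comp_polyX polyC_exp Qp.
  by apply: (exprD_pchar (p := p)); rewrite !pchar_poly.
(* Hasse derivatives of order less than l <= Q do not see X^(i Q). *)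
have lQ : (l <= Q)%N by rewrite /l /Q leq_mul2r; move: m_large; lia.
have rt x t : (t < l)%N -> (poly_XaY (r x))`_t = (poly_XaY (b x))`_t * 'X^(x.1.2 * Q).
  move=> tl; rewrite /r mulnC exprM poly_XaYM poly_XaYX tayQ.
  by rewrite coef_mul_Frobenius_low // (leq_trans tl).
have Rz z : z \in Z -> ('X - z%:P) ^+ l %| R.
  move=> zZ; apply: poly_XaY_vanish => t tl; have [zQ hz] := ZP zZ.
  have hz0 : h.[z] != 0.
    by apply: contraNneq c0 => hz0; rewrite -hz hz0 expr0n gtn_eqF // (leq_ltn_trans _ sM).
  apply: (mulfI (expf_neq0 t hz0)); rewrite mulr0.
  have := congr1 (fun q : {poly K} => q.[z]) (P0 t tl); rewrite horner0.
  rewrite /R coef_poly_XaY_comb /P !horner_sum mulr_sumr.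
  apply: etrans; apply: eq_bigr => x _; rewrite (rt _ _ tl) !hornerZ !hornerM.
  have [w1 _] := wP x t; have wE := congr1 (fun q : {poly K} => q.[z]) w1.
  rewrite hornerM horner_exp hornerM horner_exp in wE.
  rewrite mulrCA !hornerXn; congr (_ * _); rewrite mulrA wE.
  by rewrite exprM hz mulnC exprM zQ -mulrA; congr (_ * _); rewrite mulrC.
have size_r x : (size (r x) <= D + s * (M * (d - 1)) + (A - 1) * Q)%N.
  apply: leq_trans (size_polyMleq _ _) _; rewrite size_polyXn addnS /b /=.
  case: x => [[j i] e] /=.
  have [x1 x2 x3] := And3 (ltn_ord j) (ltn_ord i) (ltn_ord e).
  apply: leq_add; last by rewrite leq_mul2r; apply/orP; right; move: x2; lia.
  apply: leq_trans (size_polyMleq _ _) _; rewrite size_polyXn addSn /=.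
  have sh' := size_pow_le sh (M * j).
  have : (M * j * s <= s * (M * (d - 1)))%N.
    by rewrite mulnC leq_mul2l leq_mul2l; apply/orP; right; apply/orP; right; lia.
  by move=> hj; apply: leq_trans (leq_add (leqnn _) sh') _; move: hj; lia.
(* By the independence lemma, R = 0 would make every coefficient zero. *)
have R0 : R != 0.
  pose k (j : 'I_d) : {poly {poly K}} :=
    \sum_(i < A) (\sum_(e < D) v (j, i, e) *: 'X^e) *: 'X^i.
  apply: contraNneq vx0 => R0.
  have kj i j : (k j)`_i = if insub i is Some i' then \sum_(e < D) v (j, i', e) *: 'X^e else 0.
    rewrite coef_sum; case: insubP => [i' lti ii|]; last first.
      rewrite -leqNgt => leAi; apply: big1 => i' _; rewrite coefZ coefXn.
      by rewrite gtn_eqF ?mulr0 // (leq_trans _ leAi).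
    rewrite (bigD1 i') //= coefZ coefXn -ii eqxx mulr1 [X in _ + X]big1 ?addr0 // => l' li.
    by rewrite coefZ coefXn eq_sym (negPf (li : val l' != val i')) mulr0.
  have : k x0.1.1 = 0.
    apply: (@stepanov_nonvanishing _ h d M Q D s) => //.
    - by rewrite QE /D -mulnDr subnK ?(ltnW sM) // mulnC.
    - move=> j i; rewrite kj; case: insubP => [i' _ _|_]; last by rewrite size_poly0.
      apply: leq_trans (size_sum _ _ _) _; apply/bigmax_leqP => e _.
      apply: leq_trans (size_scale_leq _ _) _; rewrite size_polyXn.
      by apply: leq_trans (ltn_ord e) _.
    apply: etrans R0; rewrite /R /r /b [RHS](eq_bigr (fun x : I =>
       (v (x.1.1, x.1.2, x.2) *: 'X^(x.2) * 'X^(x.1.2 * Q)) * h ^+ (M * x.1.1))) => [|[[j i] e] _ /=]; last first.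
      by rewrite -!scalerAl mulrAC.
    rewrite -[RHS](pair_big predT predT (fun (y : 'I_d * 'I_A) (e : 'I_D) =>
       (v (y.1, y.2, e) *: 'X^e * 'X^(y.2 * Q)) * h ^+ (M * y.1))) /=.
    rewrite -[RHS](pair_big predT predT (fun (j : 'I_d) (i : 'I_A) =>
       \sum_(e < D) (v (j, i, e) *: 'X^e * 'X^(i * Q)) * h ^+ (M * j))) /=.
    apply: eq_bigr => j _; rewrite horner_sum mulr_suml; apply: eq_bigr => i _.
    by rewrite hornerZ hornerXn -exprM mulnC !mulr_suml.
  move/(congr1 (fun q : {poly {poly K}} => q`_x0.1.2)); rewrite kj valK coef0.
  move/(congr1 (fun q : {poly K} => q`_x0.2)); rewrite coef0 coef_sum => <-.
  rewrite (bigD1 x0.2) //= coefZ coefXn eqxx mulr1 big1 ?addr0.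
    by case: (x0) => [[]].
  by move=> e ne; rewrite coefZ coefXn eq_sym (negPf (ne : val e != val x0.2)) mulr0.
have := dvdp_leq R0 (dvdp_prod_uniq uZ Rz).
have -> : size (\prod_(z <- Z) ('X - z%:P) ^+ l) = (l * size Z).+1.
  elim: (Z) => [|z Z' IH]; first by rewrite big_nil muln0 size_poly1.
  rewrite big_cons size_monicM ?monic_exp ?monicXsubC //; last first.
    by rewrite -size_poly_gt0 IH.
  by rewrite IH size_exp_XsubC /= mulnS addnS.
move/leq_trans => /(_ _ (leq_trans (size_sum _ _ _) _)) hh.
have {hh} : (l * size Z < D + s * (M * (d - 1)) + (A - 1) * Q)%N.
  apply: hh; apply/bigmax_leqP => x _; apply: leq_trans (size_scale_leq _ _) _.
  exact: size_r.
have m0 : (0 < m)%N by apply: leq_ltn_trans m_large.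
have e1 : (s * (M * (d - 1)) <= s * Q)%N.
  by rewrite leq_mul2l QE leqW ?orbT // leq_mul2l leq_subr orbT.
have e2 : (D <= Q)%N.
  by rewrite QE (leq_trans (leq_subr _ _)) // leqW // leq_pmulr.
have e3 : ((A - 1) * Q + Q = m * Q + B * Q)%N.
  by rewrite -mulSnr -mulnDl subn1 prednK // addn_gt0 m0.
move=> hZ; rewrite -(leq_pmul2l m0).
have -> : (m * (d * size Z) = l * size Z)%N by rewrite /l; ring.
have -> : (m * (Q + m * (1 + s + B)) = m * Q + B * Q + Q + s * Q)%N by rewrite /Q; ring.
apply: leq_trans (ltnW hZ) _; apply: leq_trans (leq_add (leq_add e2 e1) (leqnn _)) _.
by rewrite -e3; move: ((A - 1) * Q)%N (s * Q)%N Q => u v' w'; lia.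
Qed.
End Stepanov.

(** * A finite field inside an algebraic closure *)

Lemma Frobenius_rmorphism (R : comNzRingType) p a : p \in [pchar R] ->
  exists f : {rmorphism R -> R}, forall x, f x = x ^+ (p ^ a).
Proof.
move=> cp; elim: a => [|a [f fE]]; first by exists idfun => x; rewrite expn0 expr1.
exists (pFrobenius_aut cp \o f) => x /=.
by rewrite pFrobenius_autE fE -exprM expnSr.
Qed.

Section ClosedPoly.
Variable K : closedFieldType.
Implicit Types P R : {poly K}.

Lemma monic_rootsP P : P \is monic -> exists rs : seq K, P = \prod_(z <- rs) ('X - z%:P).
Proof.
by move=> mP; have [rs] := closed_field_poly_normal P; rewrite (monicP mP) scale1r; exists rs.
Qed.

(** Over a closed field the multiplicities determine the list of roots up to a
    permutation. *)
Lemma monic_mup_eq P R : P \is monic -> R \is monic -> (forall x, mup x P = mup x R) -> P = R.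
Proof.
move=> /monic_rootsP [r1 ->] /monic_rootsP [r2 ->] e; apply: perm_big.
by apply/allP => x _ /=; apply/eqP; have := e x; rewrite /= !mu_prod_XsubC.
Qed.

(** The root of P is built from the roots of P, with their multiplicities
    divided by v. *)
Lemma monic_nth_root P v : P \is monic -> (forall x, v %| mup x P)%N ->
  exists2 R, R \is monic & P = R ^+ v.
Proof.
move=> mP hv; have [rs PE] := monic_rootsP mP.
pose R := \prod_(z <- undup rs) ('X - z%:P) ^+ (mup z P %/ v).
have mR : R \is monic by apply: monic_prod => z _; apply: monic_exp; apply: monicXsubC.
exists R => //; apply: monic_mup_eq => // [|x]; first exact: monic_exp.
rewrite mup_expn ?monic_neq0 //=.
have -> : mup x R = (mup x P %/ v)%N; last by rewrite mulnC divnK.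
rewrite /R; have [xr|xr] := boolP (x \in undup rs).
  rewrite (bigD1_seq x) ?undup_uniq //= mupMl ?mup_XsubCX ?eqxx //.
  rewrite -big_filter /root horner_prod prodf_seq_neq0; apply/allP => y.
  rewrite mem_filter => /andP [yx _] /=; rewrite horner_exp expf_neq0 //.
  by rewrite !hornerE subr_eq0 eq_sym.
rewrite [RHS](_ : _ = 0%N).
  rewrite mupNroot // /root horner_prod prodf_seq_neq0; apply/allP => y yr /=.
  rewrite horner_exp expf_neq0 // !hornerE subr_eq0.
  by apply: contraNneq xr => ->.
by rewrite PE mu_prod_XsubC (count_memPn _) ?div0n // -mem_undup.
Qed.

End ClosedPoly.

Lemma fixed_in_subfield (F : finFieldType) (L : fieldType) (iota : {rmorphism F -> L}) z :
  z ^+ #|F| = z -> exists a, z = iota a.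
Proof.
move=> zq; have : root (map_poly iota ('X^#|F| - 'X)) z.
  by rewrite rmorphB /= map_polyXn map_polyX /root !hornerE zq subrr.
rewrite finField_genPoly rmorph_prod /= -big_enum /root horner_prod.
have /= := prodf_seq_eq0 (enum F) predT (fun x => (map_poly iota ('X - x%:P)).[z]).
rewrite big_enum /= => -> /hasP [a _].
by rewrite rmorphB /= map_polyX map_polyC !hornerE subr_eq0 => /eqP; exists a.
Qed.

Section Closure.
Variables (F : finFieldType) (K : closedFieldType) (iota : {rmorphism F -> K}).
Variables (p e : nat).
Hypotheses (pp : prime p) (cardF : #|F| = (p ^ e)%N).
Local Notation q := #|F|.

Lemma pcharK : p \in [pchar K].
Proof. by apply: (rmorph_pchar iota); exact: (card_finPcharP cardF pp). Qed.

Lemma q_gt1 : (1 < q)%N. Proof. exact: finNzRing_gt1. Qed.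

Lemma e_gt0 : (0 < e)%N.
Proof. by have := q_gt1; rewrite cardF; case: (e). Qed.

Lemma iota_fixed a : iota a ^+ q = iota a.
Proof. by rewrite -rmorphXn expf_card. Qed.

(** A left inverse of [iota]; it is meaningful on the fixed points of z ^+ q, the
    image of [iota]. *)
Definition descend (z : K) : F := odflt 0 [pick a | iota a == z].

Lemma descend_iota a : descend (iota a) = a.
Proof.
rewrite /descend; case: pickP => [b /eqP|/(_ a)]; last by rewrite eqxx.
exact: fmorph_inj.
Qed.

Lemma descendK z : z ^+ q = z -> iota (descend z) = z.
Proof. by case/(fixed_in_subfield iota) => a ->; rewrite descend_iota. Qed.

Lemma poly_descent (P : {poly K}) : (forall i, P`_i ^+ q = P`_i) ->
  exists g, P = map_poly iota g.
Proof.
move=> hP; exists (map_poly descend P); apply/polyP=> i.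
have descend0 : descend 0 = 0 by rewrite -(rmorph0 iota) descend_iota.
by rewrite coef_map coef_map_id0 //= descendK.
Qed.

Lemma Frobenius_power k : exists f : {rmorphism K -> K}, forall z, f z = z ^+ (q ^ k).
Proof.
have [f fE] := @Frobenius_rmorphism K p (e * k) pcharK.
by exists f => z; rewrite fE cardF expnM.
Qed.

Lemma expq_inj k : injective (fun z : K => z ^+ (q ^ k)).
Proof. by have [f fE] := Frobenius_power k => x y; rewrite -!fE => /fmorph_inj. Qed.

Lemma map_poly_Frobenius (f : {rmorphism K -> K}) k (g : {poly F}) :
  (forall z, f z = z ^+ (q ^ k)) -> map_poly f (map_poly iota g) = map_poly iota g.
Proof.
move=> fE; rewrite -map_poly_comp; apply: eq_map_poly => a /=; rewrite fE.
by elim: k {fE} => [|k IH]; rewrite ?expr1 // expnS exprM iota_fixed.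
Qed.

Lemma horner_Frobenius k (g : {poly F}) x :
  (map_poly iota g).[x ^+ (q ^ k)] = (map_poly iota g).[x] ^+ (q ^ k).
Proof. by have [f fE] := Frobenius_power k; rewrite -!fE -[in LHS](map_poly_Frobenius g fE) horner_map. Qed.

Lemma mup_Frobenius k (g : {poly F}) x : g != 0 ->
  mup (x ^+ (q ^ k)) (map_poly iota g) = mup x (map_poly iota g).
Proof.
move=> g0; have [f fE] := Frobenius_power k.
by rewrite -fE -{1}(map_poly_Frobenius g fE) mup_map ?map_poly_eq0.
Qed.

Lemma expq_comp_poly k (g : {poly F}) (h := map_poly iota g) :
  h ^+ (q ^ k) = h \Po 'X^(q ^ k).
Proof.
have cp : p \in [pchar {poly K}] by rewrite pchar_poly pcharK.
have [f fE] := @Frobenius_rmorphism _ p (e * k) cp.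
have fq z : f z = z ^+ (q ^ k) by rewrite fE cardF expnM.
rewrite -fq comp_polyE -[in LHS](coefK h) poly_def rmorph_sum /=; apply: eq_bigr => i _.
rewrite -mul_polyC rmorphM /= !fq -polyC_exp mul_polyC -!exprM mulnC.
rewrite coef_map /= (_ : iota _ ^+ _ = iota g`_i) //.
by elim: (k) => [|k' IH]; rewrite ?expr1 // expnS exprM iota_fixed.
Qed.

(** The subfield of q^k elements, as the roots of X^(q^k) - X. *)
Definition subfield_seq k : seq K := sval (closed_field_poly_normal ('X^(q ^ k) - 'X)).

Lemma subfield_seqP k : (0 < k)%N ->
  [/\ uniq (subfield_seq k), size (subfield_seq k) = (q ^ k)%N &
      forall x, (x \in subfield_seq k) = (x ^+ (q ^ k) == x)].
Proof.
move=> k0; rewrite /subfield_seq; set Q := (q ^ k)%N.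
have Q1 : (1 < Q)%N by rewrite -(exp1n k) ltn_exp2r // q_gt1.
have sP : size ('X^Q - 'X : {poly K}) = Q.+1.
  by rewrite size_polyDl ?size_polyXn // size_polyN size_polyX.
have mP : ('X^Q - 'X : {poly K}) \is monic.
  by rewrite monicE lead_coefDl ?lead_coefXn // size_polyN size_polyX size_polyXn.
case: (closed_field_poly_normal _) => s /=; rewrite (monicP mP) scale1r => sE; split.
- rewrite -separable_prod_XsubC -sE unlock derivB derivXn derivX.
  have -> : ('X^(Q.-1) *+ Q : {poly K}) = 0.
    rewrite -mulr_natr -polyC_natr (_ : Q%:R = 0) ?polyC0 ?mulr0 //.
    apply/eqP; rewrite -(dvdn_pcharf pcharK) /Q cardF -expnM dvdn_exp //.
    by rewrite muln_gt0 e_gt0.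
  by rewrite sub0r coprimep_sym -scaleN1r coprimepZl ?oppr_eq0 ?oner_eq0 // coprime1p.
- by have := size_prod_XsubC s id; rewrite -sE sP => -[].
- move=> x; rewrite -root_prod_XsubC -sE /root !hornerE subr_eq0 //.
Qed.

End Closure.

(** * Multiplicative characters *)

(** A character extended by 0 at 0.  As the unit group of F is cyclic, an
    injective character generates the group of all characters. *)
Definition mult_char (F : finFieldType) (chi : F -> algC) :=
  [/\ {morph chi : x y / x * y}, chi 0 = 0, chi 1 = 1 & injective chi].

Section MultChar.
Variables (F : finFieldType) (chi : F -> algC).
Hypothesis chiP : mult_char chi.

Lemma mult_charX x n : chi (x ^+ n) = chi x ^+ n.
Proof.
case: chiP => cM _ c1 _; elim: n => [|n IH]; first by rewrite !expr0.
by rewrite !exprS cM IH.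
Qed.

Lemma expf_card1 (x : F) : x != 0 -> x ^+ #|F|.-1 = 1.
Proof.
move=> x0; apply: (mulfI x0); rewrite -exprS mulr1 prednK ?expf_card //.
exact: ltnW (finNzRing_gt1 F).
Qed.

Lemma norm_mult_char x : x != 0 -> `|chi x| = 1.
Proof.
move=> x0; have := expf_card1 x0; have := finNzRing_gt1 F.
case: #|F| => // -[//|n] _ /= xn; case: chiP => _ _ c1 _.
apply/eqP; rewrite -(@pexpr_eq1 _ _ n.+1) ?normr_ge0 //.
by rewrite -normrX -mult_charX xn c1 normr1.
Qed.

Lemma norm_mult_char_le1 x : `|chi x| <= 1.
Proof.
case: (eqVneq x 0) => [->|x0]; last by rewrite norm_mult_char.
by case: chiP => _ -> _ _; rewrite normr0 ler01.
Qed.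

Lemma exists_nontorsion u : (0 < u < #|F|.-1)%N -> exists2 y : F, y != 0 & y ^+ u != 1.
Proof.
case/andP=> u0 uN.
apply/exists_inP; apply: contraT; rewrite negb_exists_in => /forall_inP hy.
have := @max_poly_roots _ ('X^u - 1 : {poly F}) (enum (predC1 0)).
rewrite -size_poly_eq0 size_XnsubC // => /(_ isT); rewrite enum_uniq -cardE cardC1.
have -> : all (root ('X^u - 1)) (enum (predC1 (0 : F))).
  apply/allP => y; rewrite mem_enum => /hy; rewrite negbK => /eqP yu.
  by rewrite /root !hornerE yu subrr.
by move=> /(_ isT isT); rewrite ltnS leqNgt uN.
Qed.

Lemma sum_mult_char_torsion d u : (u * d = #|F|.-1)%N -> (1 < d)%N ->
  \sum_(c : F | c ^+ d == 1) chi c = 0.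
Proof.
move=> ud d1.
have q1 := finNzRing_gt1 F; have q0 : (0 < #|F|.-1)%N by case: #|F| q1 => [|[]].
have u0 : (0 < u)%N by move: q0; rewrite -ud muln_gt0 => /andP[].
have [|y y0 yu] := @exists_nontorsion u.
  by rewrite u0 -ud -[ltnLHS]muln1 ltn_pmul2l.
pose c0 := y ^+ u; have c00 : c0 != 0 by apply: expf_neq0.
have c0d : c0 ^+ d = 1 by rewrite -exprM ud expf_card1.
case: chiP => cM _ c1 ci.
have ne : chi c0 != 1 by rewrite -c1 (inj_eq ci).
set S := \sum_(_ | _) _.
have /eqP : S = chi c0 * S.
  rewrite {1}/S (reindex (fun x => c0 * x)) /=.
    rewrite mulr_sumr; apply: eq_big => [x|x _]; last exact: cM.
    by rewrite exprMn c0d mul1r.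
  by exists (fun x => c0^-1 * x) => x _; [rewrite mulKf|rewrite mulVKf].
rewrite -subr_eq0 -{1}[S]mul1r -mulrBl mulf_eq0 subr_eq0 eq_sym (negPf ne) /=.
by move/eqP.
Qed.

End MultChar.

Lemma mult_char_exists (F : finFieldType) : exists chi : F -> algC, mult_char chi.
Proof.
have /cyclicP [g gE] := field_unit_group_cyclic [set: {unit F}]%G.
have og : #[g]%g = #|F|.-1 by rewrite /order -gE card_finField_unit.
have q1 := finNzRing_gt1 F; have q0 : (0 < #|F|.-1)%N by case: #|F| q1 => [|[]].
have [z zP] := C_prim_root_exists q0.
pose dl (x : F) : nat := index x [seq FinRing.uval (g ^+ i)%g | i <- iota 0 #|F|.-1].
have dlP x : x != 0 -> (dl x < #|F|.-1)%N /\ FinRing.uval (g ^+ dl x)%g = x.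
  move=> x0; have xin : x \in [seq FinRing.uval (g ^+ i)%g | i <- iota 0 #|F|.-1].
    have : finField_unit x0 \in <[g]>%g by rewrite -gE inE.
    case/cyclePmin => i ilt xi; apply/mapP; exists i; first by rewrite mem_iota -og.
    by rewrite -xi.
  have lt : (dl x < #|F|.-1)%N by rewrite -index_mem size_map size_iota in xin.
  split => //; have := nth_index 0 xin; rewrite -/(dl x).
  by rewrite (nth_map 0%N) ?size_iota // nth_iota.
exists (fun x => if x == 0 then 0 else z ^+ dl x).
have gval i : FinRing.uval (g ^+ i)%g != 0 by rewrite -unitfE; apply: (valP (g ^+ i)%g).
have eqz x i : x = FinRing.uval (g ^+ i)%g -> z ^+ dl x = z ^+ i.
  move=> xi; have x0 : x != 0 by rewrite xi.
  have [_ dx] := dlP x x0; apply/eqP; rewrite (eq_prim_root_expr zP) -og -eq_expg_mod_order.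
  by apply/eqP/val_inj; rewrite /= dx.
split=> [x y||| x y].
- rewrite mulf_eq0; case: eqP => [|/eqP x0]; first by rewrite mul0r.
  case: eqP => [|/eqP y0] /=; first by rewrite mulr0.
  rewrite -exprD; apply: eqz; rewrite expgD /=.
  by have [_ ->] := dlP x x0; have [_ ->] := dlP y y0.
- by rewrite eqxx.
- by rewrite oner_eq0; rewrite (eqz _ 0%N).
- have z0 n : z ^+ n != 0.
    apply/expf_neq0/eqP => z00; have /eqP := prim_expr_order zP.
    by rewrite z00 expr0n gtn_eqF // eq_sym oner_eq0.
  case: eqP => [->|/eqP x0]; case: eqP => [->|/eqP y0] //.
  + by move/esym/eqP; rewrite (negPf (z0 _)).
  + by move/eqP; rewrite (negPf (z0 _)).
  move/eqP; rewrite (eq_prim_root_expr zP).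
  have [xl xE] := dlP x x0; have [yl yE] := dlP y y0.
  by rewrite /eqn !modn_small // => /eqP dxy; rewrite -xE -yE dxy.
Qed.

(** * Square-root cancellation with an unspecified constant *)

Section StepanovSum.
Variables (F : finFieldType) (K : closedFieldType) (iota : {rmorphism F -> K}).
Variables (p e : nat).
Hypotheses (pp : prime p) (cardF : #|F| = (p ^ e)%N).
Variables (chi : F -> algC).
Hypothesis chiP : mult_char chi.
Local Notation q := #|F|.
Local Notation descend := (descend iota).

(** On the field with q^k elements, z ^+ norm_exp k is the norm of z down to F. *)
Definition norm_exp k := (\sum_(i < k) q ^ i)%N.

Lemma norm_expE k : (q.-1 * norm_exp k).+1 = (q ^ k)%N.
Proof. by rewrite /norm_exp -predn_exp prednK // expn_gt0 (ltnW (q_gt1 F)). Qed.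

Lemma norm_exp_prod k z : z ^+ norm_exp k = \prod_(i < k) z ^+ (q ^ i) :> K.
Proof. by rewrite /norm_exp expr_sum. Qed.

(** Only the extensions of even degree 2k are considered: the square root of
    their cardinality is the integer q^k, and infinitely many degrees suffice to
    bound the inverse roots of the L-function. *)
Definition sqrt_bounded_norm_sums (H : {poly F}) := exists C k0 : nat, forall k,
  (k0 <= k)%N ->
  `| \sum_(x <- subfield_seq F K (2 * k))
        chi (descend ((map_poly iota H).[x] ^+ norm_exp (2 * k))) | <= (C * q ^ k)%:R.

(** The norm of h(x)^u is y = h(x)^((Q-1)/d), a d-th root of unity in F unless
    h(x) = 0.  Each fibre y = c has at most Q/d + O(sqrt Q) points, and together
    the fibres miss only the zeros of h; as chi sums to 0 over the d-th roots
    of unity, only the deficits from the upper bound contribute. *)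
Lemma stepanov_sum_irr (h : {poly F}) u d : (u * d = q.-1)%N -> (1 < d)%N -> h \is monic ->
  (forall e0, (0 < e0 < d)%N -> exists rho, ~~ (d %| e0 * mup rho (map_poly iota h))%N) ->
  sqrt_bounded_norm_sums (h ^+ u).
Proof.
move=> ud d1 mh irr; pose s := (size h).-1; pose C0 := (1 + s + 2 * d * (1 + d * s))%N.
exists (C0 + s)%N, (2 * d + 2 + 2 * d * s)%N => k hk.
have k20 : (0 < 2 * k)%N by move: hk; lia.
have [uK sK KkP] := subfield_seqP iota pp cardF k20.
set Kk := subfield_seq F K (2 * k) in uK sK KkP *.
pose m := (q ^ k)%N; pose M := (u * norm_exp (2 * k))%N.
have QE : (m * m = q ^ (2 * k))%N by rewrite /m -expnD mul2n addnn.
have QM : (m * m = (M * d).+1)%N.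
  by rewrite QE -norm_expE -ud /M; congr _.+1; rewrite mulnAC.
have d0 : (0 < d)%N by apply: ltnW.
have h0 : map_poly iota h != 0 by rewrite map_poly_eq0 monic_neq0.
have M0 : (0 < M)%N.
  have : (1 < m * m)%N.
    rewrite QE; apply: leq_ltn_trans (ltn_expl (2 * k) (q_gt1 F)); lia.
  by rewrite QM; case: (M).
pose Z c := [seq x <- Kk | (map_poly iota h).[x] ^+ M == iota c].
have Zbound c : c ^+ d == 1 -> (d * size (Z c) <= m * m + m * C0)%N.
  move=> /eqP cd; have c0 : iota c != 0.
    rewrite fmorph_eq0; apply: contra_eq_neq cd => ->.
    by rewrite expr0n gtn_eqF // eq_sym oner_eq0.
  apply: (@stepanov_count _ (map_poly iota h) p (e * (2 * k)) d M m s (iota c)) => //.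
  - exact: (pcharK iota pp cardF).
  - by rewrite QE cardF [RHS]expnM.
  - by rewrite size_map_poly /s; case: (size h).
  - by rewrite QE; apply: (expq_comp_poly iota pp cardF).
  - by apply: leq_trans (_ : k < m)%N; rewrite ?ltnS // ltn_expl // q_gt1.
  - exact: filter_uniq.
  - by move=> x; rewrite mem_filter KkP QE => /andP [/eqP -> /eqP ->].
have ptc x : x \in Kk -> (map_poly iota h).[x] != 0 ->
    exists2 c, c ^+ d == 1 & (map_poly iota h).[x] ^+ M = iota c.
  rewrite KkP => /eqP xQ; set y := _.[x] => y0.
  have yQ : y ^+ (m * m) = y by rewrite QE /y -(horner_Frobenius iota pp cardF) xQ.
  have yMd : (y ^+ M) ^+ d = 1.
    by apply: (mulfI y0); rewrite -exprM -exprS -QM yQ mulr1.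
  have yMq : (y ^+ M) ^+ q = y ^+ M.
    by rewrite -(prednK (ltnW (q_gt1 F))) exprS -ud mulnC exprM yMd expr1n mulr1.
  have [c cE] := fixed_in_subfield iota yMq; exists c => //.
  by rewrite -(inj_eq (fmorph_inj iota)) rmorphXn /= -cE yMd rmorph1.
have pt x : x \in Kk ->
    chi (descend ((map_poly iota (h ^+ u)).[x] ^+ norm_exp (2 * k))) =
    \sum_(c : F | c ^+ d == 1) chi c * ((map_poly iota h).[x] ^+ M == iota c)%:R.
  move=> xK; rewrite rmorphXn /= horner_exp -exprM -/M.
  have [y0|y0] := eqVneq (map_poly iota h).[x] 0.
    have descend0 : descend 0 = 0 by rewrite -(rmorph0 iota) descend_iota.
    rewrite y0 expr0n gtn_eqF //= descend0; case: chiP => _ -> _ _.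
    rewrite big1 // => c /eqP cd; rewrite eq_sym fmorph_eq0.
    case: eqP => [c0|_]; last by rewrite mulr0.
    by move/eqP: cd; rewrite c0 expr0n gtn_eqF // eq_sym oner_eq0.
  have [c cd cE] := ptc x xK y0; rewrite cE descend_iota (bigD1 c) //=.
  rewrite eqxx mulr1 big1 ?addr0 // => c' /andP [_ ne].
  by rewrite (inj_eq (fmorph_inj iota)) eq_sym (negPf ne) mulr0.
rewrite big_seq (eq_bigr _ pt) -big_seq exchange_big /=.
have cnt c : \sum_(x <- Kk) chi c * ((map_poly iota h).[x] ^+ M == iota c)%:R =
             chi c * (size (Z c))%:R.
  rewrite -mulr_sumr; congr (_ * _); rewrite -natr_sum /Z size_filter -sum1_count.
  by rewrite [in RHS]big_mkcond /=; congr _%:R; apply: eq_bigr => x _; case: (_ == _).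
rewrite (eq_bigr _ (fun c _ => cnt c)).
set S := \sum_(_ | _) _.
pose T := (m * m + m * C0)%N.
have dS : d%:R * S = - \sum_(c : F | c ^+ d == 1) chi c * (T - d * size (Z c))%:R.
  rewrite -sumrN mulr_sumr.
  have -> : \sum_(c : F | c ^+ d == 1) d%:R * (chi c * (size (Z c))%:R) =
     \sum_(c : F | c ^+ d == 1) (- (chi c * (T - d * size (Z c))%:R) + T%:R * chi c).
    apply: eq_bigr => c /Zbound hc; rewrite natrB // natrM; ring.
  by rewrite big_split /= -mulr_sumr (sum_mult_char_torsion chiP ud d1) mulr0 addr0.
have card_c : (#|[pred c : F | c ^+ d == 1%R]| <= d)%N.
  have := @max_poly_roots _ ('X^d - 1 : {poly F}) (enum [pred c : F | c ^+ d == 1]).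
  rewrite -size_poly_eq0 size_XnsubC // => /(_ isT); rewrite enum_uniq -cardE.
  have -> : all (root ('X^d - 1)) (enum [pred c : F | c ^+ d == 1]).
    by apply/allP => y; rewrite mem_enum inE => /eqP yu; rewrite /root !hornerE yu subrr.
  by move=> /(_ isT isT).
have sumZ : (m * m - s <= \sum_(c : F | c ^+ d == 1%R) size (Z c))%N.
  have cnt0 : (count (root (map_poly iota h)) Kk <= s)%N.
    rewrite -size_filter -ltnS.
    have -> : s.+1 = size (map_poly iota h).
      by rewrite size_map_poly /s prednK // size_poly_gt0 monic_neq0.
    apply: max_poly_roots => //; last exact: filter_uniq.
    by apply/allP => x; rewrite mem_filter => /andP [].
  have pt2 x : x \in Kk -> (1 <= root (map_poly iota h) x +
      \sum_(c : F | c ^+ d == 1%R) ((map_poly iota h).[x] ^+ M == iota c))%N.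
    move=> xK; rewrite /root; case: eqP => [//|/eqP y0].
    have [c cd cE] := ptc x xK y0.
    by rewrite add0n (bigD1 c) //= cE eqxx.
  have : (\sum_(x <- Kk) 1 <= \sum_(x <- Kk) (root (map_poly iota h) x +
      \sum_(c : F | c ^+ d == 1%R) ((map_poly iota h).[x] ^+ M == iota c)))%N.
    by rewrite big_seq [in leqRHS]big_seq; apply: leq_sum.
  rewrite sum1_size sK -QE big_split /= exchange_big /=.
  have -> : (\sum_(x <- Kk) root (map_poly iota h) x = count (root (map_poly iota h)) Kk)%N.
    by rewrite -sum1_count [in RHS]big_mkcond; apply: eq_bigr => x _; case: (root _ _).
  have -> : (\sum_(c : F | c ^+ d == 1%R) \sum_(x <- Kk) ((map_poly iota h).[x] ^+ M == iota c)
     = \sum_(c : F | c ^+ d == 1%R) size (Z c))%N.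
    apply: eq_bigr => c _; rewrite /Z size_filter -sum1_count [in RHS]big_mkcond.
    by apply: eq_bigr => x _; case: (_ == _).
  by move=> hh; rewrite leq_subLR; apply: leq_trans hh _; rewrite leq_add2r.
have nS : d%:R * `|S| <= (d * ((C0 + s) * m))%:R.
  rewrite -[d%:R]ger0_norm ?ler0n // -normrM dS normrN.
  apply: le_trans (ler_norm_sum _ _ _) _.
  apply: (@le_trans _ _ (\sum_(c : F | c ^+ d == 1) (T - d * size (Z c))%:R)).
    apply: ler_sum => c _; rewrite normrM [X in _ * X]ger0_norm ?ler0n //.
    by rewrite ler_piMl ?ler0n // norm_mult_char_le1.
  rewrite -natr_sum ler_nat.
  have : (\sum_(c : F | c ^+ d == 1%R) (T - d * size (Z c)) +
          \sum_(c : F | c ^+ d == 1%R) (d * size (Z c)) <= d * T)%N.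
    rewrite -big_split /= (eq_bigr (fun=> T)) => [|c /Zbound hc]; last by rewrite subnK.
    by rewrite sum_nat_const leq_mul2r card_c orbT.
  rewrite -big_distrr /= => h1.
  have m0 : (0 < m)%N by rewrite expn_gt0 ltnW // q_gt1.
  have h2 : (d * (m * m) <= d * (\sum_(c : F | c ^+ d == 1%R) size (Z c) + s))%N.
    by rewrite leq_mul2l addnC -leq_subLR sumZ orbT.
  have h3 : (d * s <= d * (s * m))%N by rewrite leq_mul2l leq_pmulr ?orbT.
  rewrite mulnDr in h2; rewrite /T mulnDr in h1; rewrite mulnDl mulnDr [(C0 * m)%N]mulnC.
  move: h1 h2 h3; move: (d * (m * m))%N (d * (m * C0))%N (d * (s * m))%N (d * s)%N => t1 t2 t3 t4.
  by move: (\sum_(_ | _) _)%N (d * _)%N => t5 t6; lia.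
by rewrite -(@ler_pM2l _ d%:R) ?ltr0n // -natrM.
Qed.

(** Induction on d: if the irreducibility hypothesis of [stepanov_sum_irr] fails
    for some e0 < d, then v = d / gcd(e0, d) divides all multiplicities of h.
    The monic v-th root of h is unique, so it is fixed by Frobenius and has its
    coefficients in F, and d can be replaced by d / v.  The case d = 1 is
    excluded because H is not a (q-1)-th power. *)
Lemma sqrt_norm_sums (H : {poly F}) : H \is monic ->
  (forall h, h \is monic -> H <> h ^+ q.-1) -> sqrt_bounded_norm_sums H.
Proof.
move=> mH nH.
suff main d : forall u h, (u * d = q.-1)%N -> h \is monic -> H = h ^+ u -> sqrt_bounded_norm_sums H.
  by apply: (main q.-1 1%N H); rewrite ?mul1n ?expr1.
have q10 : (0 < q.-1)%N by case: q (q_gt1 F) => [|[]].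
elim/ltn_ind: d => d IH u h ud mh HE.
have d1 : (1 < d)%N.
  case: d ud {IH} => [|[|//]] ud; first by move: q10; rewrite -ud muln0.
  by case: (nH h mh); rewrite HE -ud muln1.
have [rs rsE] := monic_rootsP (monic_map iota mh).
case: (boolP [exists e0 : 'I_d, (0 < e0)%N && all (fun r => d %| e0 * mup r (map_poly iota h))%N rs]).
  case/existsP => e0 /andP [e00 /allP rsP].
  pose v := (d %/ gcdn e0 d)%N.
  have g0 : (0 < gcdn e0 d)%N by rewrite gcdn_gt0 e00.
  have vd : (v * gcdn e0 d = d)%N by rewrite divnK // dvdn_gcdr.
  have v1 : (1 < v)%N.
    rewrite ltn_divRL ?dvdn_gcdr // mul1n.
    by apply: leq_ltn_trans (dvdn_leq e00 (dvdn_gcdl _ _)) (ltn_ord e0).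
  have v0 : (0 < v)%N := ltnW v1.
  have vmup x : (v %| mup x (map_poly iota h))%N.
    have [/rsP hd|xr] := boolP (x \in rs); last first.
      by rewrite rsE mu_prod_XsubC (count_memPn xr).
    have e0E : ((e0 %/ gcdn e0 d) * gcdn e0 d = e0)%N by rewrite divnK // dvdn_gcdl.
    have cop : coprime v (e0 %/ gcdn e0 d).
      rewrite /coprime -(@eqn_pmul2r (gcdn e0 d)) // mul1n muln_gcdl.
      by rewrite vd e0E gcdnC.
    rewrite -(Gauss_dvdr _ cop) -(@dvdn_pmul2r (gcdn e0 d)) //.
    by rewrite vd mulnAC e0E.
  have [R mR hR] := monic_nth_root (monic_map iota mh) vmup.
  have [f fE] := Frobenius_power iota pp cardF 1.
  have fR : map_poly f R = R.
    apply: monic_mup_eq => // [|x]; first exact: monic_map.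
    apply/eqP; rewrite -(@eqn_pmul2l v) // -!mup_expn ?monic_neq0 ?monic_map //.
    by rewrite -rmorphXn /= -hR (map_poly_Frobenius iota h fE).
  have [|g gE] := @poly_descent _ _ iota R.
    by move=> i; rewrite -[in RHS]fR coef_map /= fE expn1.
  have hg : h = g ^+ v.
    by apply: (map_poly_inj iota); rewrite hR gE rmorphXn.
  apply: (IH (gcdn e0 d) _ (v * u)%N g).
  - by rewrite -[ltnRHS]vd ltn_Pmull.
  - by rewrite -ud -[X in (_ = _ * X)%N]vd; ring.
  - by move: mR; rewrite gE map_monic.
  - by rewrite HE hg exprM.
rewrite negb_exists => /forallP hno; rewrite HE; apply: (stepanov_sum_irr ud d1 mh).
move=> e0 /andP [e00 e0d]; have := hno (Ordinal e0d); rewrite negb_and e00 /=.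
by case/allPn => x _ hx; exists x.
Qed.

End StepanovSum.

(** * Monic polynomials and Frobenius orbits *)

Section MonicSums.
Variables (F : finFieldType) (lam : {poly F} -> algC).
Hypothesis lamM : {morph lam : g h / g * h}.

(** Monic polynomials of degree m are indexed by the rows of their lower
    coefficients, so that sums over them range over a finite type. *)
Definition monic_of m (u : 'rV[F]_m) : {poly F} := 'X^m + rVpoly u.

(** The m-th coefficient of the L-function of [lam]. *)
Definition lcoef m := \sum_(u : 'rV[F]_m) lam (monic_of u).
Definition row_of m (P : {poly F}) : 'rV[F]_m := poly_rV (P - 'X^m).

Lemma size_monic_of m u : size (@monic_of m u) = m.+1.
Proof. by rewrite size_polyDl size_polyXn // ltnS size_poly. Qed.

Lemma monic_monic_of m u : @monic_of m u \is monic.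
Proof. by rewrite monicE lead_coefDl ?lead_coefXn // size_polyXn ltnS size_poly. Qed.

Lemma monic_ofK m : cancel (@monic_of m) (@row_of m).
Proof. by move=> u; rewrite /row_of /monic_of addrC addKr rVpolyK. Qed.

Lemma row_ofK m P : P \is monic -> size P = m.+1 -> monic_of (row_of m P) = P.
Proof.
move=> mP sP; rewrite /monic_of poly_rV_K ?subrKC //.
apply/leq_sizeP => j; rewrite leq_eqVlt => /predU1P [<-|mj].
  rewrite coefB coefXn eqxx; move/monicP: mP; rewrite lead_coefE sP /= => ->.
  by rewrite subrr.
by rewrite coefB coefXn gtn_eqF // subr0 nth_default // sP.
Qed.

Lemma lcoef0 : lcoef 0 = lam 1.
Proof.
rewrite /lcoef (big_pred1 0) => [|u]; first by rewrite /monic_of linear0 addr0.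
by rewrite /= [u]thinmx0 eqxx.
Qed.

Lemma lcoef1 : lcoef 1 = \sum_(a : F) lam ('X - a%:P).
Proof.
rewrite /lcoef (reindex (fun a : F => row_of 1 ('X - a%:P))) /=.
  by apply: eq_bigr => a _; rewrite row_ofK ?monicXsubC ?size_XsubC.
exists (fun u => - (monic_of u)`_0) => [a _|u _].
  by rewrite row_ofK ?monicXsubC ?size_XsubC // coefB coefX coefC /= sub0r opprK.
apply: (can_inj (@monic_ofK 1)); rewrite row_ofK ?monicXsubC ?size_XsubC //.
rewrite polyCN opprK; apply/polyP => i; rewrite coefD coefX coefC.
case: i => [|[|i]] /=; rewrite ?add0r ?addr0 //.
  have /monicP := monic_monic_of u; by rewrite lead_coefE size_monic_of /= => ->.
by rewrite nth_default // size_monic_of.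
Qed.

Lemma lcoef_dvd m k (g0 : {poly F}) : (k <= m)%N -> g0 \is monic -> size g0 = k.+1 ->
  \sum_(u : 'rV[F]_m | g0 %| monic_of u) lam (monic_of u) = lam g0 * lcoef (m - k).
Proof.
move=> km mg sg; rewrite /lcoef mulr_sumr.
have g00 : g0 != 0 := monic_neq0 mg.
have P1 (v : 'rV_(m - k)) : g0 * monic_of v \is monic by rewrite monicMl ?monic_monic_of.
have P2 (v : 'rV_(m - k)) : size (g0 * monic_of v) = m.+1.
  by rewrite size_monicM ?monic_neq0 ?monic_monic_of // sg size_monic_of /= addnS subnKC.
rewrite (reindex_onto (fun v => row_of m (g0 * monic_of v))
   (fun u => row_of (m - k) (monic_of u %/ g0))) /=; last first.
  move=> u hu; have E := divpK hu.
  have mQ : monic_of u %/ g0 \is monic.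
    by have := monic_monic_of u; rewrite -{1}E monicMr.
  rewrite row_ofK // ?[g0 * _]mulrC ?E ?monic_ofK //.
  by rewrite size_divp // size_monic_of sg /= subSn.
apply: eq_big => [v|v _]; last by rewrite row_ofK // lamM.
by rewrite row_ofK // dvdp_mulr //= mulKp // monic_ofK eqxx.
Qed.

(** Multiplication by g0 modulo r, with the quotient by r kept, permutes the
    monic polynomials of degree m; it multiplies the sum by [lam g0]. *)
Lemma lcoef_eq0 m (r g0 : {poly F}) : r != 0 -> (size r <= m.+1)%N ->
  coprimep g0 r -> lam g0 != 1 ->
  (forall g h, g %% r = h %% r -> lam g = lam h) -> lcoef m = 0.
Proof.
move=> r0 sr cop ne per.
pose P u := @monic_of m u - monic_of u %% r + (g0 * monic_of u) %% r.
have sz (h : {poly F}) : (size (h %% r)%R <= m)%N.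
  by rewrite -ltnS (leq_trans (ltn_modpN0 _ r0)).
(* Only the remainder modulo r is changed, so degree m and monicity are kept. *)
pose phi (u : 'rV[F]_m) : 'rV[F]_m := poly_rV (rVpoly u - monic_of u %% r + (g0 * monic_of u) %% r).
have phiE u : monic_of (phi u) = P u.
  rewrite /monic_of poly_rV_K /P /monic_of ?addrA //.
  apply: leq_trans (size_polyD _ _) _; rewrite geq_max sz andbT.
  by apply: leq_trans (size_polyD _ _) _; rewrite geq_max size_polyN sz size_poly.
have Pmod u : P u %% r = (g0 * monic_of u) %% r.
  by rewrite /P 2!modpD modpN !modp_id subrr add0r.
have phi_inj : injective phi.
  move=> u v /(congr1 (@monic_of m)); rewrite !phiE => E.
  have : r %| g0 * (monic_of u - monic_of v).
    by rewrite mulrBr /dvdp modpD modpN -!Pmod E subrr.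
  rewrite Gauss_dvdpr 1?coprimep_sym // /dvdp modpD modpN subr_eq0 => /eqP e1.
  apply: (can_inj (@monic_ofK m)); move: E; rewrite /P.
  by rewrite -(modp_mul g0 (monic_of u)) e1 modp_mul => /addIr /addIr.
have : lcoef m = lam g0 * lcoef m.
  rewrite {1}/lcoef (reindex_inj phi_inj) mulr_sumr; apply: eq_bigr => u _.
  by rewrite -lamM phiE; apply: per; rewrite Pmod.
move/eqP; rewrite -subr_eq0 -{1}[lcoef m]mul1r -mulrBl mulf_eq0 subr_eq0 eq_sym.
by rewrite (negPf ne) => /eqP.
Qed.

End MonicSums.

Lemma sum_count_mem (T : eqType) (U rs : seq T) : uniq U -> {subset rs <= U} ->
  (\sum_(x <- U) count_mem x rs = size rs)%N.
Proof.
move=> uU sub; under eq_bigr do rewrite -sum1_count big_mkcond /=.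
rewrite exchange_big /= -[RHS]sum1_size; rewrite big_seq [RHS]big_seq.
apply: eq_bigr => y /sub yU; rewrite (bigD1_seq y) //= eqxx big1 ?addn0 // => x ne.
by rewrite eq_sym (negPf ne).
Qed.

Lemma count_multiples e mu m : (0 < e)%N -> (e * mu <= m)%N ->
  (\sum_(1 <= k < m.+1) ((e %| k) && (k %/ e <= mu)) = mu)%N.
Proof.
move=> e0 le; rewrite /index_iota subn1 /=.
have -> : (\sum_(k <- iota 1 m) ((e %| k) && (k %/ e <= mu)) =
   size [seq k <- iota 1 m | (e %| k) && (k %/ e <= mu)])%N.
  rewrite size_filter -sum1_count [in RHS]big_mkcond /=.
  by apply: eq_bigr => k _; case: (_ && _).
rewrite -[RHS](size_iota 1) -[RHS](size_map (fun j => e * j)%N); apply: perm_size.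
apply: uniq_perm; first by rewrite filter_uniq ?iota_uniq.
  by rewrite map_inj_uniq ?iota_uniq // => i j /eqP; rewrite eqn_pmul2l // => /eqP.
move=> k; rewrite mem_filter mem_iota; apply/andP/mapP => [[/andP [ek km] k1]|[j]].
  exists (k %/ e)%N; last by rewrite mulnC divnK.
  by rewrite mem_iota divn_gt0 // dvdn_leq //; case/andP: k1.
rewrite mem_iota => /andP [j1 jm] ->; rewrite dvdn_mulr // mulKn // muln_gt0 e0 j1 !add1n !ltnS.
by split=> //; apply: leq_trans le; rewrite leq_mul2l -ltnS -add1n jm orbT.
Qed.

Section FrobeniusOrbits.
Variables (F : finFieldType) (K : closedFieldType) (iota : {rmorphism F -> K}).
Variables (p e : nat).
Hypotheses (pp : prime p) (cardF : #|F| = (p ^ e)%N).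
Local Notation q := #|F|.
Local Notation descend := (descend iota).

(** For x in the field with q^k elements this is the characteristic polynomial
    of x over F: a power of the minimal polynomial, with the Frobenius orbit of x
    as its roots. *)
Definition orbit_poly k (x : K) : {poly K} := \prod_(0 <= i < k) ('X - (x ^+ (q ^ i))%:P).
Definition orbit_poly_base k x : {poly F} := map_poly descend (orbit_poly k x).

Lemma monic_orbit_poly k x : orbit_poly k x \is monic.
Proof. by apply: monic_prod => i _; apply: monicXsubC. Qed.

Lemma size_orbit_poly k x : size (orbit_poly k x) = k.+1.
Proof. by rewrite /orbit_poly size_prod_XsubC /index_iota size_iota subn0. Qed.

Lemma orbit_poly_baseE k x : (0 < k)%N -> x ^+ (q ^ k) = x -> map_poly iota (orbit_poly_base k x) = orbit_poly k x.
Proof.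
move=> k0 xk; have [f fE] := Frobenius_power iota pp cardF 1.
have fP : map_poly f (orbit_poly k x) = orbit_poly k x.
  rewrite /orbit_poly rmorph_prod /=.
  case: k k0 xk => // k _ xk; rewrite [RHS]big_nat_recl // big_nat_recr //= mulrC.
  rewrite rmorphB /= map_polyX map_polyC /= fE expn1 -exprM -expnSr xk; congr (_ * _).
  apply: eq_bigr => i _; rewrite rmorphB /= map_polyX map_polyC /= fE expn1.
  by rewrite -exprM -expnSr.
have [|g gE] := @poly_descent _ _ iota (orbit_poly k x).
  by move=> i; rewrite -[in RHS]fP coef_map /= fE expn1.
have descend0 : descend 0 = 0 by rewrite -(rmorph0 iota) descend_iota.
rewrite /orbit_poly_base gE; congr (map_poly _ _); apply/polyP => i.
by rewrite coef_map_id0 // coef_map /= descend_iota.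
Qed.

Lemma monic_orbit_poly_base k x : (0 < k)%N -> x ^+ (q ^ k) = x -> orbit_poly_base k x \is monic.
Proof. by move=> k0 xk; rewrite -(map_monic iota) orbit_poly_baseE ?monic_orbit_poly. Qed.

Lemma size_orbit_poly_base k x : (0 < k)%N -> x ^+ (q ^ k) = x -> size (orbit_poly_base k x) = k.+1.
Proof. by move=> k0 xk; rewrite -(size_map_poly iota) orbit_poly_baseE ?size_orbit_poly. Qed.

Lemma expq_cancel (x : K) i j : x ^+ (q ^ (i + j)) = x ^+ (q ^ i) -> x ^+ (q ^ j) = x.
Proof.
by rewrite addnC expnD exprM => h; apply: (expq_inj iota pp cardF (k := i)).
Qed.

(** If d is the degree of x over F, the admissible k are the multiples j * d, and
    [orbit_poly (j * d) x] is the j-th power of the minimal polynomial of x; it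
    divides g for j at most the multiplicity of x in g, and for no other j. *)
Lemma orbit_poly_count (g : {poly F}) m (x : K) : g != 0 -> (size g <= m.+1)%N ->
  (\sum_(1 <= k < m.+1) ((x ^+ (q ^ k) == x) && (orbit_poly k x %| map_poly iota g)%R) =
   mup x (map_poly iota g))%N.
Proof.
move=> g0 sg; set gK := map_poly iota g.
have gK0 : gK != 0 by rewrite map_poly_eq0.
have sgK : (size gK <= m.+1)%N by rewrite size_map_poly.
case: (boolP [exists k : 'I_m.+1, (0 < k)%N && (x ^+ (q ^ k) == x)]); last first.
  rewrite negb_exists => /forallP hno; rewrite big_nat big1 => [|k /andP [k0 km]]; last first.
    by have := hno (Ordinal km); rewrite k0 /= => /negPf ->.
  apply/esym/mupNroot; apply/negP => rx.
  have roots_x : all (root gK) [seq x ^+ (q ^ i) | i <- index_iota 0 m.+1].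
    apply/allP => y /mapP [i _ ->]; rewrite /root (horner_Frobenius iota pp cardF).
    by rewrite expf_eq0 expn_gt0 (ltnW (q_gt1 F)) /=; apply: rx.
  have uniq_x : uniq [seq x ^+ (q ^ i) | i <- index_iota 0 m.+1].
    rewrite map_inj_in_uniq ?iota_uniq // => i j; rewrite !mem_index_iota /=.
    wlog ij : i j / (i < j)%N => [W im jm E|im jm E].
      by case: (ltngtP i j) => // ij; [exact: W|apply/esym; exact: W].
    have := hno (Ordinal (leq_ltn_trans (leq_subr i j) jm)); rewrite /= subn_gt0 ij /=.
    by rewrite (@expq_cancel x i (j - i)) ?eqxx // subnKC // ltnW.
  have := max_poly_roots gK0 roots_x uniq_x.
  by rewrite size_map size_iota subn0 ltnNge sgK.
move=> hex; have ex : exists k, (0 < k)%N && (x ^+ (q ^ k) == x).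
  by case/existsP: hex => k hk; exists k.
case: (ex_minnP ex) => d /andP [d0 /eqP xd] dmin.
have per i j : x ^+ (q ^ (j * d + i)) = x ^+ (q ^ i).
  elim: j => [|j IH]; first by rewrite mul0n.
  by rewrite mulSn -addnA expnD exprM xd.
have dP k : (x ^+ (q ^ k) == x) = (d %| k)%N.
  rewrite {1}(divn_eq k d) per /dvdn; case: (posnP (k %% d)) => [->|k0].
    by rewrite expn0 expr1 !eqxx.
  apply/negP => hk.
  by have := dmin (k %% d)%N; rewrite k0 hk leqNgt ltn_pmod // => /(_ isT).
have orbit_polyM j : orbit_poly (j * d) x = orbit_poly d x ^+ j.
  elim: j => [|j IH]; first by rewrite mul0n /orbit_poly big_nil expr0.
  rewrite exprS -IH /orbit_poly mulSn (@big_cat_nat _ _ _ d) ?leq_addr //=; congr (_ * _).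
  rewrite -{1}[d]add0n big_addn addKn; apply: eq_bigr => i _.
  by rewrite -[d in (i + d)%N]mul1n addnC per.
have dvdE j : (orbit_poly (j * d) x %| gK) = (j <= mup x gK)%N.
  rewrite orbit_polyM mup_geq //; apply/idP/idP => h.
    apply: dvdp_trans h; apply: dvdp_exp2r.
    by rewrite /orbit_poly big_ltn // expn0 expr1 dvdp_mulIl.
  have -> : orbit_poly d x ^+ j =
      \prod_(y <- [seq x ^+ (q ^ i) | i <- index_iota 0 d]) ('X - y%:P) ^+ j.
    by rewrite big_map prodrXl.
  apply: dvdp_prod_uniq => [|y /mapP [i _ ->]].
    rewrite map_inj_in_uniq ?iota_uniq // => i i'; rewrite !mem_index_iota /=.
    wlog ij : i i' / (i < i')%N => [W im jm E|im jm E].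
      by case: (ltngtP i i') => // ij; [exact: W|apply/esym; exact: W].
    have := @expq_cancel x i (i' - i); rewrite subnKC ?(ltnW ij) // => /(_ (esym E)) /eqP.
    rewrite dP => /dvdn_leq; rewrite subn_gt0 => /(_ ij); rewrite leqNgt.
    by rewrite (leq_ltn_trans (leq_subr i i') jm).
  rewrite -mup_geq // (mup_Frobenius iota pp cardF) // mup_geq //.
rewrite -[RHS](@count_multiples d _ m) //; last first.
  have := dvdE (mup x gK); rewrite leqnn => /(dvdp_leq gK0).
  by rewrite size_orbit_poly mulnC => /leq_trans /(_ sgK).
apply: eq_big_nat => k /andP [k0 km]; rewrite dP.
by case: (boolP (d %| k)%N) => //= dk; rewrite -[in LHS](divnK dk) dvdE.
Qed.

End FrobeniusOrbits.

(** * Newton identities and the size of inverse roots *)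

Section NewtonSums.
Variables (F : finFieldType) (K : closedFieldType) (iota : {rmorphism F -> K}).
Variables (p e : nat).
Hypotheses (pp : prime p) (cardF : #|F| = (p ^ e)%N).
Variable lam : {poly F} -> algC.
Hypothesis lamM : {morph lam : g h / g * h}.
Local Notation q := #|F|.
Local Notation sub := (subfield_seq F K).

Let uniq_sub k : (0 < k)%N -> uniq (sub k).
Proof. by case/(subfield_seqP iota pp cardF). Qed.

Let mem_sub k x : (0 < k)%N -> (x \in sub k) = (x ^+ (q ^ k) == x).
Proof. by case/(subfield_seqP iota pp cardF). Qed.

(** The logarithmic derivative of the L-function, coefficient by coefficient: m
    is the number of roots of a monic g of degree m, and [orbit_poly_count]
    replaces each multiplicity by the number of orbit polynomials that divide g. *)
Lemma lcoef_newton m : m%:R * lcoef lam m =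
  \sum_(1 <= k < m.+1) (\sum_(x <- sub k) lam (orbit_poly_base iota k x)) * lcoef lam (m - k).
Proof.
(* A finite set that contains all roots of all monic polynomials of degree m. *)
pose U := undup (flatten [seq sub k | k <- index_iota 1 m.+1]).
have subU k x : (0 < k)%N -> (k <= m)%N -> x \in sub k -> x \in U.
  move=> k0 km xk; rewrite mem_undup; apply/flattenP; exists (sub k) => //.
  by apply: map_f; rewrite mem_index_iota k0 ltnS.
have mupU (u : 'rV[F]_m) : (\sum_(x <- U) mup x (map_poly iota (monic_of u)) = m)%N.
  have u0 : monic_of u != 0 := monic_neq0 (monic_monic_of u).
  have [rs rsE] := monic_rootsP (monic_map iota (monic_monic_of u)).
  rewrite rsE; under eq_bigr do rewrite mu_prod_XsubC.
  rewrite sum_count_mem ?undup_uniq //.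
    have := size_prod_XsubC rs id; rewrite -rsE size_map_poly size_monic_of.
    by case.
  move=> x xrs; have := @orbit_poly_count _ _ iota _ _ pp cardF (monic_of u) m x u0.
  rewrite size_monic_of leqnn => /(_ isT) E.
  have : (0 < mup x (map_poly iota (monic_of u)))%N.
    by rewrite rsE mu_prod_XsubC -has_count has_pred1.
  rewrite -E lt0n sum_nat_seq_neq0 => /hasP [k]; rewrite mem_index_iota /= => /andP [k0 km].
  case xk: (x ^+ (q ^ k) == x) => //= _; apply: (subU k) => //.
  by rewrite mem_sub // xk.
rewrite /lcoef mulr_sumr.
transitivity (\sum_(u : 'rV[F]_m) \sum_(x <- U) \sum_(1 <= k < m.+1)
   (if (x \in sub k) && (orbit_poly F k x %| map_poly iota (monic_of u)) then lam (monic_of u) else 0)).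
  apply: eq_bigr => u _; rewrite -{1}(mupU u) natr_sum mulr_suml; apply: eq_bigr => x _.
  have := @orbit_poly_count _ _ iota _ _ pp cardF (monic_of u) m x (monic_neq0 (monic_monic_of u)).
  rewrite size_monic_of leqnn => /(_ isT) <-; rewrite natr_sum mulr_suml.
  apply: eq_big_nat => k /andP [k0 _]; rewrite mem_sub //.
  by case: (_ && _); rewrite ?mul1r ?mul0r.
rewrite exchange_big /=; under eq_bigr do rewrite exchange_big /=.
rewrite exchange_big /=; apply: eq_big_nat => k /andP [k0 km].
have perm_k : perm_eq [seq x <- U | x \in sub k] (sub k).
  apply: uniq_perm; rewrite ?filter_uniq ?undup_uniq ?uniq_sub // => x.
  rewrite mem_filter; apply/andP/idP => [[]//|xk]; split=> //.
  exact: (subU k).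
rewrite mulr_suml -(perm_big _ perm_k) /= big_filter [RHS]big_mkcond /=.
apply: eq_bigr => x _; case: (boolP (x \in sub k)) => [|_] /=; last by rewrite big1.
rewrite mem_sub // => /eqP xk; rewrite -(lcoef_dvd lamM) ?(monic_orbit_poly_base iota pp cardF) //.
  by rewrite -big_mkcond /=; apply: eq_bigl => u; rewrite -(dvdp_map iota) (orbit_poly_baseE iota pp cardF).
exact: (size_orbit_poly_base iota pp cardF).
Qed.

End NewtonSums.

Section PowerSums.
Variable C : numClosedFieldType.
Implicit Types (rs : seq C).

Lemma geometric_poly (w : C) n :
  (\poly_(i < n) w ^+ i.+1) * (1 - w *: 'X) = w%:P - w ^+ n.+1 *: 'X^n.
Proof.
elim: n => [|n IHn].
  by rewrite poly_def big_ord0 mul0r expr1 expr0 alg_polyC subrr.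
rewrite poly_def big_ord_recr /= -(poly_def n (fun i => w ^+ i.+1)) mulrDl IHn.
rewrite mulrBr mulr1 -scalerAl -scalerAr.
by rewrite scalerA -exprSr -exprSr addrA subrK.
Qed.

(** L'/L is the sum of -w / (1 - w X), whose geometric series is cut at X^n; R
    is the error made by the cut. *)
Lemma newton_identity_mod rs n :
  exists R, (\prod_(w <- rs) (1 - w *: 'X))^`() =
   R * 'X^n - (\sum_(w <- rs) \poly_(i < n) w ^+ i.+1) * \prod_(w <- rs) (1 - w *: 'X).
Proof.
elim: rs => [|w rs [R IH]].
  by exists 0; rewrite !big_nil mul0r mul0r subr0 -polyC1 derivC.
rewrite !big_cons derivM {}IH; set L := \prod_(_ <- _) _; set G := \sum_(_ <- _) _.
exists ((1 - w *: 'X) * R - w ^+ n.+1 *: L).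
have -> : (1 - w *: 'X)^`() = - w%:P.
  by rewrite derivB -polyC1 derivC sub0r derivZ derivX alg_polyC.
transitivity (((1 - w *: 'X) * R - w ^+ n.+1 *: L) * 'X^n -
  ((\poly_(i < n) w ^+ i.+1) * (1 - w *: 'X)) * L - G * ((1 - w *: 'X) * L)); last by ring.
by rewrite geometric_poly -!mul_polyC; ring.
Qed.

Lemma newton_identity rs m (c := fun i => (\prod_(w <- rs) (1 - w *: 'X))`_i) :
  m.+1%:R * c m.+1 = - \sum_(i < m.+1) (\sum_(w <- rs) w ^+ i.+1) * c (m - i)%N.
Proof.
have [R /(congr1 (fun P : {poly C} => P`_m))] := newton_identity_mod rs m.+1.
rewrite coef_deriv coefB coefMXn ltnSn sub0r mulr_natl => ->; congr (- _).
rewrite coefM; apply: eq_bigr => i _; congr (_ * _).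
by rewrite coef_sum; apply: eq_bigr => w _; rewrite coef_poly ltn_ord.
Qed.

Lemma bernoulli_ineq (x : C) n : 1 <= x -> 1 + n%:R * (x - 1) <= x ^+ n.
Proof.
move=> x1; elim: n => [|n IH]; first by rewrite mul0r addr0.
rewrite exprS; apply: (@le_trans _ _ (x * (1 + n%:R * (x - 1)))).
  have -> : x * (1 + n%:R * (x - 1)) = 1 + n.+1%:R * (x - 1) + n%:R * (x - 1) ^+ 2.
    by rewrite -natr1; ring.
  by rewrite lerDl mulr_ge0 // exprn_ge0 // subr_ge0.
by rewrite ler_wpM2l // (le_trans ler01).
Qed.

End PowerSums.

(** If a > b then (a/b)^j is bounded, against Bernoulli's inequality. *)
Lemma geometric_growth (a b C k : algC) n0 : 0 < b -> 0 < k -> 0 <= a ->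
  (forall j, (n0 <= j)%N -> k * a ^+ j <= C * b ^+ j) -> a <= b.
Proof.
move=> b0 k0 a0 h; rewrite real_leNgt ?(ger0_real a0) ?(gtr0_real b0) //; apply/negP => ba.
pose x := a / b.
have x1 : 1 < x by rewrite ltr_pdivlMr // mul1r.
have hx j : (n0 <= j)%N -> x ^+ j <= C / k.
  move=> /h; rewrite expr_div_n ler_pdivlMr // mulrAC ler_pdivrMr ?exprn_gt0 //.
  by rewrite mulrC.
pose y := C / k / (x - 1).
have x10 : 0 < x - 1 by rewrite subr_gt0.
have Ck0 : 0 <= C / k.
  by apply: le_trans (hx n0 (leqnn _)); rewrite exprn_ge0 // (le_trans ler01) // ltW.
have y0 : 0 <= y by rewrite divr_ge0 // ltW.
have yN := archi_boundP y0; set N := Num.bound y in yN.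
have := le_trans (bernoulli_ineq (n0 + N) (ltW x1)) (hx (n0 + N)%N (leq_addr _ _)).
have r1 : 1 + (n0 + N)%:R * (x - 1) \is Num.real.
  by rewrite ger0_real // addr_ge0 ?ler01 // mulr_ge0 ?ler0n // ltW.
apply/negP; rewrite -real_ltNge ?(ger0_real Ck0) //.
apply: (@le_lt_trans _ _ (y * (x - 1))); first by rewrite divfK // gt_eqF.
apply: (@lt_le_trans _ _ (N%:R * (x - 1))); first by rewrite ltr_pM2r.
by rewrite -[leLHS]add0r lerD ?ler01 // ler_pM2r // ler_nat leq_addl.
Qed.

(** A polynomial A that vanishes at the members of ws other than z combines
    consecutive power sums into count(z) A(z) z^j, so z^j grows no faster than
    the power sums. *)
Lemma power_sums_bound (ws : seq algC) (C b : algC) n0 : 0 < b ->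
  (forall j, (n0 <= j)%N -> `|\sum_(w <- ws) w ^+ j| <= C * b ^+ j) ->
  forall z, z \in ws -> `|z| <= b.
Proof.
move=> b0 h z zw.
pose A : {poly algC} := \prod_(y <- [seq y <- undup ws | y != z]) ('X - y%:P).
have Az : A.[z] != 0.
  rewrite horner_prod prodf_seq_neq0; apply/allP => y; rewrite mem_filter /=.
  by case/andP => yz _; rewrite !hornerE subr_eq0 eq_sym.
have Ay y : y \in ws -> y != z -> A.[y] = 0.
  move=> yw yz; apply/eqP; rewrite -[_ == 0]/(root A y) root_prod_XsubC.
  by rewrite mem_filter yz mem_undup.
have E j : \sum_(t < size A) A`_t * (\sum_(w <- ws) w ^+ (j + t)) =
    (count_mem z ws)%:R * z ^+ j * A.[z].
  transitivity (\sum_(w <- ws) w ^+ j * A.[w]).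
    under eq_bigr do rewrite mulr_sumr.
    rewrite exchange_big /=; apply: eq_bigr => w _; rewrite horner_coef mulr_sumr.
    by apply: eq_bigr => t _; rewrite exprD; ring.
  rewrite big_seq (eq_bigr (fun w => if w == z then z ^+ j * A.[z] else 0)).
    rewrite -big_seq -big_mkcond /= big_const_seq iter_addr addr0.
    by rewrite -mulrA mulr_natl.
  by move=> w ww; case: eqP => [->//|/eqP wz]; rewrite Ay // mulr0.
apply: (@geometric_growth _ _ (\sum_(t < size A) `|A`_t| * C * b ^+ t)
   (`|A.[z]|) n0) => // [|j jn]; first by rewrite normr_gt0.
apply: (@le_trans _ _ `|(count_mem z ws)%:R * z ^+ j * A.[z]|).
  rewrite !normrM normrX mulrC ler_wpM2r ?normr_ge0 //.
  rewrite ler_peMl ?exprn_ge0 ?normr_ge0 // normr_nat ler1n -has_count has_pred1 //.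
rewrite -E mulr_suml; apply: le_trans (ler_norm_sum _ _ _) _; apply: ler_sum => t _.
rewrite normrM -!mulrA ler_wpM2l ?normr_ge0 // -exprD addnC.
by rewrite addnC (le_trans (h _ _)) // (leq_trans jn) // leq_addr.
Qed.

(** * The L-function and the Weil bound *)

Section LFunction.
Variables (F : finFieldType) (K : closedFieldType) (iota : {rmorphism F -> K}).
Variables (p e : nat).
Hypotheses (pp : prime p) (cardF : #|F| = (p ^ e)%N).
Variables (chi : F -> algC).
Hypothesis chiP : mult_char chi.
Variable H : {poly F}.
Local Notation q := #|F|.
Local Notation descend := (descend iota).
Local Notation "p ^K" := (map_poly iota p) (at level 2, format "p ^K").

Variable rs : seq K.
Hypothesis rsE : H^K = \prod_(z <- rs) ('X - z%:P).

(** The resultant of g and H, up to a sign, in the form that is visibly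
    multiplicative in g and depends on g only modulo the radical of H. *)
Definition resultant_at (g : {poly F}) : K := \prod_(z <- rs) g^K.[z].

(** [resultant_at g] is fixed by Frobenius, so it comes from F. *)
Definition norm_char g := chi (descend (resultant_at g)).

Lemma resultant_atM g h : resultant_at (g * h) = resultant_at g * resultant_at h.
Proof. by rewrite /resultant_at -big_split /=; apply: eq_bigr => z _; rewrite rmorphM hornerM. Qed.

Lemma resultant_at_fixed g : resultant_at g ^+ q = resultant_at g.
Proof.
have perm_rs : perm_eq [seq z ^+ q | z <- rs] rs.
  have [f fE] := Frobenius_power iota pp cardF 1.
  apply: prod_XsubC_eq; rewrite -rsE -[in RHS](map_poly_Frobenius iota H fE) rsE rmorph_prod big_map /=.
  by apply: eq_bigr => z _; rewrite rmorphB /= map_polyX map_polyC /= fE expn1.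
rewrite -[in RHS]/(resultant_at g) /resultant_at -[RHS](perm_big _ perm_rs) big_map /=.
rewrite -prodrXl; apply: eq_bigr => z _.
by rewrite -[q in RHS]expn1 (horner_Frobenius iota pp cardF) expn1.
Qed.

Lemma descendM x y : x ^+ q = x -> y ^+ q = y -> descend (x * y) = descend x * descend y.
Proof.
move=> hx hy; apply: (fmorph_inj iota); rewrite rmorphM !descendK //.
by rewrite exprMn hx hy.
Qed.

Lemma norm_charM : {morph norm_char : g h / g * h}.
Proof.
move=> g h; rewrite /norm_char resultant_atM descendM ?resultant_at_fixed //.
by case: chiP => -> .
Qed.

Lemma norm_char1 : norm_char 1 = 1.
Proof.
rewrite /norm_char /resultant_at rmorph1 big1 => [|z _]; last by rewrite hornerC.
by rewrite -(rmorph1 iota) descend_iota; case: chiP.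
Qed.

Lemma norm_char_le1 g : `|norm_char g| <= 1.
Proof. exact: norm_mult_char_le1. Qed.

Let sgn : F := (-1) ^+ size rs.

Lemma sgn_neq0 : sgn != 0.
Proof. by rewrite signr_eq0. Qed.

Lemma prod_roots_sub x : \prod_(z <- rs) (z - x) = iota sgn * H^K.[x].
Proof.
rewrite rsE horner_prod /sgn rmorphXn rmorphN1; move: (rs) => s.
elim: s => [|z s IH]; first by rewrite !big_nil mulr1.
by rewrite !big_cons IH exprS !hornerE /=; ring.
Qed.

Lemma norm_char_XsubC a : norm_char ('X - a%:P) = chi sgn * chi H.[a].
Proof.
rewrite /norm_char /resultant_at.
under eq_bigr do rewrite rmorphB /= map_polyX map_polyC /= !hornerE.
rewrite prod_roots_sub horner_map -rmorphM /= descend_iota.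
by case: chiP => ->.
Qed.

(** The orbit polynomial of x has the conjugates of x as roots, so that its
    resultant with H is, up to a sign, the norm of H(x). *)
Lemma norm_char_orbit k x : (0 < k)%N -> x ^+ (q ^ k) = x ->
  norm_char (orbit_poly_base iota k x) = chi sgn ^+ k * chi (descend (H^K.[x] ^+ norm_exp F k)).
Proof.
move=> k0 xk; have Nfix : (H^K.[x] ^+ norm_exp F k) ^+ q = H^K.[x] ^+ norm_exp F k.
  rewrite -exprM; have [->|h0] := eqVneq H^K.[x] 0.
    rewrite !expr0n muln_eq0 (gtn_eqF (ltnW (q_gt1 F))) orbF //.
  have E : (norm_exp F k * q = norm_exp F k + q.-1 * norm_exp F k)%N.
    by rewrite -mulSn prednK ?(ltnW (q_gt1 F)) // mulnC.
  rewrite E exprD -[RHS]mulr1; congr (_ * _); apply: (mulfI h0).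
  by rewrite -exprS norm_expE mulr1 -(horner_Frobenius iota pp cardF) xk.
rewrite /norm_char /resultant_at (orbit_poly_baseE iota pp cardF) // -mult_charX //.
under eq_bigr do rewrite /orbit_poly horner_prod.
rewrite exchange_big /=.
have -> : \prod_(0 <= i < k) \prod_(z <- rs) ('X - (x ^+ (q ^ i))%:P).[z] =
    iota (sgn ^+ k) * H^K.[x] ^+ norm_exp F k.
  rewrite norm_exp_prod -(big_mkord predT (fun i => H^K.[x] ^+ (q ^ i))) /= rmorphXn /=.
  rewrite -[k in _ ^+ k]subn0 -prodr_const_nat -big_split /=; apply: eq_bigr => i _.
  rewrite -(horner_Frobenius iota pp cardF) -prod_roots_sub; apply: eq_bigr => z _.
  by rewrite !hornerE.
rewrite descendM ?iota_fixed //; case: chiP => -> _ _ _.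
by rewrite descend_iota.
Qed.

Lemma norm_char_mod r g h : (forall z, z \in rs -> root r^K z) -> g %% r = h %% r -> norm_char g = norm_char h.
Proof.
move=> rr E; rewrite /norm_char /resultant_at; congr (chi (descend _)).
rewrite big_seq [RHS]big_seq; apply: eq_bigr => z /rr /eqP rz.
have ev f : f^K.[z] = (f %% r)^K.[z].
  by rewrite {1}(divp_eq f r) rmorphD rmorphM /= hornerD hornerM rz mulr0 add0r.
by rewrite ev E -ev.
Qed.

(** If the character were 1 at the orbit polynomials of all x that are not roots
    of r, its sum over the field with q^(2k) elements would be q^(2k) up to the
    number of roots of r, which exceeds C q^k for large k. *)
Lemma norm_char_nontrivial r : r != 0 -> sqrt_bounded_norm_sums iota chi H ->
  exists g, coprimep g r /\ norm_char g != 1.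
Proof.
move=> r0 [C [k0 bound]]; pose s := size r.
(* With this k, q^k (q^k - C) > 2 s. *)
pose k := (k0 + C + 2 * s + 1)%N.
have k20 : (0 < 2 * k)%N by rewrite /k; lia.
have [uK sK KP'] := subfield_seqP iota pp cardF k20.
have kk : (k0 <= k)%N by rewrite /k; lia.
set Kk := subfield_seq F K (2 * k) in uK sK KP'.
have := bound k kk; rewrite -/Kk.
case: (boolP (has (fun x => ~~ root r^K x && (norm_char (orbit_poly_base iota (2 * k) x) != 1)) Kk)).
  case/hasP => x xK /andP [rx ne] _; exists (orbit_poly_base iota (2 * k) x); split=> //.
  have xk : x ^+ (q ^ (2 * k)) = x by apply/eqP; rewrite -KP'.
  rewrite -(coprimep_map iota) (orbit_poly_baseE iota pp cardF) // coprimep_sym.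
  rewrite /orbit_poly; elim/big_ind: _ => [|u v|i _]; first exact: coprimep1.
    by rewrite coprimepMr => -> ->.
  rewrite coprimep_XsubC /root (horner_Frobenius iota pp cardF) expf_eq0 negb_and rx orbT //.
rewrite -all_predC => /allP hall hb; exfalso.
pose S := \sum_(x <- Kk) norm_char (orbit_poly_base iota (2 * k) x).
have xk x : x \in Kk -> x ^+ (q ^ (2 * k)) = x by rewrite KP' => /eqP.
have nS : `|S| <= (C * q ^ k)%:R.
  have -> : S = chi sgn ^+ (2 * k) *
     \sum_(x <- Kk) chi (descend (H^K.[x] ^+ norm_exp F (2 * k))).
    rewrite /S mulr_sumr big_seq [RHS]big_seq; apply: eq_bigr => x /xk hx.
    by rewrite norm_char_orbit.
  by rewrite normrM normrX (norm_mult_char chiP) ?sgn_neq0 // expr1n mul1r.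
have cnt : (count (root r^K) Kk <= s)%N.
  rewrite -size_filter /s -(size_map_poly iota); apply: ltnW.
  apply: max_poly_roots; rewrite ?map_poly_eq0 ?filter_uniq //.
  by apply/allP => x; rewrite mem_filter => /andP [].
have low : (q ^ (2 * k))%:R - (2 * s)%:R <= `|S|.
  have E : (q ^ (2 * k))%:R - S = \sum_(x <- Kk) (1 - norm_char (orbit_poly_base iota (2 * k) x)).
    by rewrite sumrB /= -sK -[in LHS](sum1_size Kk) natr_sum.
  have B : `|(q ^ (2 * k))%:R - S| <= (2 * s)%:R.
    rewrite E; apply: le_trans (ler_norm_sum _ _ _) _.
    apply: (@le_trans _ _ (\sum_(x <- Kk) (2 * root r^K x)%:R)).
      rewrite big_seq [leRHS]big_seq; apply: ler_sum => x xK.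
      have := hall x xK; rewrite /= negb_and !negbK.
      case: (root _ _) => /= [_|/eqP ->]; last by rewrite subrr normr0.
      apply: le_trans (ler_normB _ _) _; rewrite normr1 [X in _ <= X]mulr2n.
      by rewrite lerD // norm_char_le1.
    rewrite -natr_sum ler_nat -big_distrr leq_mul2l /=.
    apply: leq_trans cnt; rewrite -sum1_count [leqRHS]big_mkcond /=.
    by apply: leq_sum => x _; case: (root _ _).
  rewrite lerBlDl -lerBlDr; apply: le_trans B.
  apply: le_trans (lerB_dist _ _); by rewrite normr_nat.
have : (q ^ (2 * k))%:R - (2 * s)%:R <= (C * q ^ k)%:R :> algC by apply: le_trans low nS.
rewrite lerBlDr -natrD ler_nat; apply/negP; rewrite -ltnNge.
have kq : (k < q ^ k)%N by rewrite ltn_expl // q_gt1.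
have -> : (q ^ (2 * k) = q ^ k * q ^ k)%N by rewrite -expnD mul2n addnn.
by move: kq; rewrite /k; move: (q ^ _)%N => Q; nia.
Qed.

End LFunction.

Section Weil.
Variables (F : finFieldType) (p e : nat).
Hypotheses (pp : prime p) (cardF : #|F| = (p ^ e)%N).
Variables (chi : F -> algC).
Hypothesis chiP : mult_char chi.
Local Notation q := #|F|.

(** The polynomial r only serves as a modulus for the character
    g |-> chi(Res(g, H)): the L-function has degree at most s because r has degree
    at most s + 1. *)
Theorem weil_bound (H r : {poly F}) s t : H \is monic ->
  (forall h, h \is monic -> H <> h ^+ q.-1) ->
  H %| r ^+ t -> r != 0 -> (size r <= s.+2)%N ->
  `|\sum_(a : F) chi H.[a]| <= s%:R * sqrtC q%:R.
Proof.
move=> mH nH Hr r0 sr.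
have [K [iota _]] := countable_algebraic_closure F.
have [rs rsE] := monic_rootsP (monic_map iota mH).
pose lam := norm_char iota chi rs.
have lM : {morph lam : g h / g * h} := norm_charM pp cardF chiP rsE.
have tsb := sqrt_norm_sums iota pp cardF chiP mH nH.
have rr z : z \in rs -> root (map_poly iota r) z.
  rewrite -root_prod_XsubC -rsE => Hz.
  have := Hr; rewrite -(dvdp_map iota) rmorphXn => /dvdpP [u uE].
  have : root (map_poly iota r ^+ t) z by rewrite uE rootM Hz orbT.
  by rewrite /root horner_exp expf_eq0 => /andP [].
have [g0 [cop ne]] := norm_char_nontrivial pp cardF chiP rsE r0 tsb.
have c0 m : (s.+1 <= m)%N -> lcoef lam m = 0.
  move=> sm; apply: (lcoef_eq0 lM r0 _ cop ne); first by apply: leq_trans sr _.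
  by move=> g h; apply: norm_char_mod.
have c00 : lcoef lam 0 = 1 by rewrite lcoef0; exact: norm_char1.
pose L : {poly algC} := \poly_(i < s.+1) lcoef lam i.
have Lc i : L`_i = lcoef lam i.
  by rewrite coef_poly ltnS; case: leqP => // /c0 ->.
have L0 : L != 0.
  by apply: contra_eq_neq c00 => L0; rewrite -Lc L0 coef0 eq_sym oner_eq0.
(* L has constant coefficient 1: normalise its factors at 0. *)
have [ws [wsE sws]] : exists ws : seq algC, L = \prod_(w <- ws) (1 - w *: 'X) /\ (size ws <= s)%N.
  have [zs zsE] := closed_field_poly_normal L.
  have szs : (size zs <= s)%N.
    rewrite -ltnS -(size_prod_XsubC zs id) -(size_scale _ (_ : lead_coef L != 0))
      ?lead_coef_eq0 //.
    by rewrite -zsE size_poly.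
  exists [seq z^-1 | z <- zs]; rewrite size_map; split=> //.
  have L00 : L.[0] = 1 by rewrite horner_coef0 Lc.
  have zs0 z : z \in zs -> z != 0.
    move=> zin; apply: contra_eq_neq L00 => z0; rewrite zsE hornerZ.
    have : root (\prod_(z <- zs) ('X - z%:P)) 0 by rewrite root_prod_XsubC -z0.
    by move/eqP ->; rewrite mulr0 eq_sym oner_eq0.
  have pz : \prod_(z <- zs) ('X - z%:P) =
      \prod_(z <- zs) (- z) *: \prod_(z <- [seq z^-1 | z <- zs]) (1 - z *: 'X).
    rewrite big_map -mul_polyC rmorph_prod /= -big_split /=.
    rewrite big_seq [RHS]big_seq; apply: eq_bigr => z /zs0 z0.
    by rewrite mulrBr mulr1 mul_polyC scalerA mulNr divff // scaleN1r opprK addrC polyCN.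
  rewrite zsE pz scalerA [X in X *: _](_ : _ = 1) ?scale1r //.
  apply: etrans _ L00; rewrite [in RHS]zsE hornerZ; congr (_ * _).
  rewrite horner_prod; apply: eq_bigr => z _.
  by rewrite !hornerE ?sub0r.
pose S k := \sum_(x <- subfield_seq F K k) lam (orbit_poly_base iota k x).
(* Both sequences satisfy the same recursion with leading coefficient 1. *)
have SE k : S k.+1 = - \sum_(w <- ws) w ^+ k.+1.
  have [k' lek] := ubnP k; elim: k' k lek => // k' IH k lek.
  have N1 := newton_identity ws k; rewrite -wsE in N1.
  have N2 := lcoef_newton iota pp cardF lM k.+1.
  move: N2; rewrite -Lc N1 big_add1 /= big_mkord -sumrN.
  rewrite !big_ord_recr /= !subSS subnn Lc c00 !mulr1 => /esym.
  rewrite (eq_bigr (fun i : 'I_k => - ((\sum_(w <- ws) w ^+ i.+1) * L`_(k - i)))); last first.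
    move=> i _; rewrite -/(S _) IH ?mulNr ?Lc ?subSS //.
    by apply: leq_trans (ltn_ord i) _; rewrite -ltnS.
  by move/addrI.
have [C [k0 bound]] := tsb.
(* The bound is available for even exponents: use the power sums of the w^2. *)
have ws_bound w : w \in ws -> `|w| <= sqrtC q%:R.
  move=> win; have q0 : (0 : algC) < q%:R by rewrite ltr0n (ltnW (q_gt1 F)).
  rewrite -(@ler_pXn2r _ 2) ?nnegrE ?normr_ge0 ?sqrtC_ge0 ?ler0n // sqrtCK -normrX.
  apply: (@power_sums_bound [seq w ^+ 2 | w <- ws] C%:R _ k0.+1 q0); last exact: map_f.
  move=> j jk; rewrite big_map.
  under eq_bigr do rewrite -exprM.
  have j0 : (0 < 2 * j)%N by move: jk; lia.
  have := SE (2 * j).-1; rewrite prednK // => /(congr1 Num.norm); rewrite normrN => <-.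
  have -> : S (2 * j)%N = chi ((-1) ^+ size rs) ^+ (2 * j) *
     \sum_(x <- subfield_seq F K (2 * j))
        chi (descend iota ((map_poly iota H).[x] ^+ norm_exp F (2 * j))).
    have [_ _ mK] := subfield_seqP iota pp cardF j0.
    rewrite /S mulr_sumr big_seq [RHS]big_seq; apply: eq_bigr => x.
    by rewrite mK => /eqP xk; rewrite /lam (norm_char_orbit pp cardF chiP rsE).
  rewrite normrM normrX (norm_mult_char chiP) ?signr_eq0 // expr1n mul1r.
  by rewrite -natrX -natrM bound // ltnW.
have c1E : lcoef lam 1 = - \sum_(w <- ws) w.
  have := newton_identity ws 0; rewrite -wsE /= mul1r big_ord1 !Lc subnn c00 mulr1 => ->.
  by under eq_bigr do rewrite expr1.
have -> : `|\sum_(a : F) chi H.[a]| = `|lcoef lam 1|.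
  rewrite lcoef1 /lam; under [in RHS]eq_bigr do rewrite (norm_char_XsubC chiP rsE).
  by rewrite -mulr_sumr normrM (norm_mult_char chiP) ?signr_eq0 // mul1r.
rewrite c1E normrN; apply: le_trans (ler_norm_sum _ _ _) _.
apply: (@le_trans _ _ (\sum_(w <- ws) sqrtC q%:R)).
  by rewrite big_seq [leRHS]big_seq; apply: ler_sum.
rewrite big_const_seq count_predT iter_addr addr0 -[leLHS]mulr_natl.
by rewrite ler_wpM2r ?sqrtC_ge0 ?ler0n // ler_nat.
Qed.
End Weil.

(** * The indicator of primitive elements *)

Section Vinogradov.
Variables (F : finFieldType) (chi : F -> algC).
Hypothesis chiP : mult_char chi.
Local Notation N := (#|F|.-1).

Let N0 : (0 < N)%N.
Proof. by have := finNzRing_gt1 F; case: #|F| => [|[]]. Qed.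

Definition nonpowers (ps : seq nat) (a : F) := all (fun p => a ^+ (N %/ p) != 1) ps.

(** Orthogonality of the p characters trivial on p-th powers; the trivial one is
    kept apart. *)
Lemma nonpower_expansion p (a : F) : prime p -> (p %| N)%N -> a != 0 ->
  (a ^+ (N %/ p) != 1)%:R = (1 - p%:R^-1) - p%:R^-1 * \sum_(1 <= i < p) chi a ^+ (i * (N %/ p)).
Proof.
move=> pp pN a0; have p0 : p%:R != 0 :> algC by rewrite pnatr_eq0 -lt0n prime_gt0.
set y := chi a ^+ (N %/ p).
have yp : y ^+ p = 1 by rewrite -exprM divnK // -mult_charX // expf_card1 //; case: chiP.
have E : \sum_(1 <= i < p) chi a ^+ (i * (N %/ p)) = \sum_(i < p) y ^+ i - 1.
  rewrite -(big_mkord predT (fun i => y ^+ i)) [in RHS]big_ltn ?prime_gt0 //= expr0 addrC addKr.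
  by apply: eq_bigr => i _; rewrite -exprM mulnC.
rewrite E; have [y1|y1] := eqVneq y 1.
  have -> : a ^+ (N %/ p) == 1.
    by case: chiP => _ _ c1 ci; rewrite -(inj_eq ci) mult_charX // -/y y1 c1.
  rewrite y1; under eq_bigr do rewrite expr1n.
  by rewrite sumr_const card_ord mulrBr mulVf // mulr1 subrr.
have -> : a ^+ (N %/ p) != 1.
  apply: contra_neq y1 => a1; rewrite /y -mult_charX // a1; by case: chiP.
have -> : \sum_(i < p) y ^+ i = 0.
  have /eqP : (y - 1) * \sum_(i < p) y ^+ i = 0 by rewrite -subrX1 yp subrr.
  by rewrite mulf_eq0 subr_eq0 (negPf y1) => /eqP.
by rewrite sub0r mulrN1 opprK subrK.
Qed.

(** Each prime multiplies the constant term by 1 - 1/p and replaces a total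
    weight w of the other terms by (1 - 1/p) (2 w + th).  An exponent that is
    killed by the product of the earlier primes stays non-trivial when a multiple
    of N / p is added, because p is a new prime. *)
Lemma nonpowers_expansion ps : uniq ps -> all prime ps -> all (fun p => p %| N)%N ps ->
  exists (th : algC) (s : seq (algC * nat)),
  [/\ 0 < th,
      forall ce, ce \in s -> (N %| ce.2 * \prod_(p <- ps) p)%N /\ ~~ (N %| ce.2)%N,
      \sum_(ce <- s) `|ce.1| <= ((2 ^ size ps)%:R - 1) * th &
      forall a, a != 0 -> (nonpowers ps a)%:R = th + \sum_(ce <- s) ce.1 * chi a ^+ ce.2].
Proof.
elim: ps => [|p ps IH] /=.
  move=> _ _ _; exists 1, [::]; split; rewrite ?ltr01 ?big_nil ?subrr ?mul0r // => a _.
  by rewrite big_nil addr0.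
case/andP=> pnin ups /andP [pp aps] /andP [pN adv].
have [th [s [th0 sP sA sE]]] := IH ups aps adv.
have p1 : (1 : algC) < p%:R by rewrite ltr1n prime_gt1.
have p0 : (0 : algC) < p%:R by rewrite ltr0n prime_gt0.
pose k : algC := 1 - p%:R^-1.
have k0 : 0 < k by rewrite subr_gt0 invf_lt1.
pose g := (N %/ p)%N.
have gp : (g * p = N)%N by rewrite divnK.
have g0 : (0 < g)%N by rewrite divn_gt0 ?prime_gt0 // dvdn_leq.
pose s1 := [seq (ce.1 * k, ce.2) | ce <- s].
pose s2 := [seq (- (th / p%:R), i * g)%N | i <- index_iota 1 p].
pose s3 := [seq (- (ce.1 / p%:R), ce.2 + i * g)%N | ce <- s, i <- index_iota 1 p].
exists (th * k), (s1 ++ s2 ++ s3); split.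
- by rewrite mulr_gt0.
- move=> ce; rewrite !mem_cat big_cons => /or3P [/mapP [ce' /sP [h1 h2] ->]|/mapP [i hi ->]|].
  + by split=> //=; rewrite mulnCA dvdn_mull.
  + split=> /=.
      by rewrite -mulnA [(g * _)%N]mulnA gp dvdn_mull // dvdn_mulr.
    rewrite -[X in (X %| _)%N]gp [(g * p)%N]mulnC dvdn_pmul2r //.
    by move: hi; rewrite mem_index_iota => /andP [i0 ip]; rewrite gtnNdvd.
  case/allpairsP => -[[c e] i] /= [/sP [/= h1 h2] hi ->] /=.
  have h3 : (N %| e * \prod_(p <- ps) p)%N by [].
  split.
    rewrite mulnDl dvdn_add //; first by rewrite mulnCA dvdn_mull.
    by rewrite -mulnA [(g * _)%N]mulnA gp dvdn_mull // dvdn_mulr.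
  apply/negP => h4; have : (N %| (e + i * g) * \prod_(p <- ps) p)%N by rewrite dvdn_mulr.
  rewrite mulnDl dvdn_addr // [(i * g)%N]mulnC -mulnA -gp dvdn_pmul2l //.
  rewrite Euclid_dvdM // => /orP [|]; last first.
    rewrite Euclid_dvd_prod // big_has => /hasP [p' p'in].
    rewrite dvdn_prime2 ?(allP aps p' p'in) // => /eqP pE.
    by move: pnin; rewrite pE p'in.
  by move: hi; rewrite mem_index_iota => /andP [i0 ip]; rewrite gtnNdvd.
- rewrite !big_cat /= !big_map big_allpairs_dep /=.
  have kE : p%:R^-1 * (p.-1)%:R = k.
    by rewrite /k -subn1 natrB ?prime_gt0 // mulrBr mulr1 mulVf // lt0r_neq0.
  have n1 (x : algC) : \sum_(1 <= i < p) `| - (x / p%:R)| = `|x| * k.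
    by rewrite sumr_const_nat -[LHS]mulr_natr normrN normrM normfV normr_nat -mulrA subn1 kE.
  rewrite n1; under [X in _ + (_ + X)]eq_bigr do rewrite n1.
  under eq_bigr do rewrite normrM (gtr0_norm k0).
  rewrite -mulr_suml (gtr0_norm th0) expnS.
  set A := \sum_(_ <- _) _ in sA *.
  have -> : A * k + (th * k + A * k) = (2 * A + th) * k by ring.
  have -> : ((2 * 2 ^ size ps)%:R - 1) * (th * k) = (2 * (((2 ^ size ps)%:R - 1) * th) + th) * k.
    by rewrite natrM; ring.
  by rewrite ler_pM2r // lerD2r ler_pM2l // ltr0n.
- move=> a a0.
  rewrite !big_cat /= !big_map big_allpairs_dep /=.
  rewrite -mulnb natrM sE // nonpower_expansion // -/g -/k.
  set G := \sum_(1 <= i < p) _.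
  have -> : \sum_(1 <= i < p) - (th / p%:R) * chi a ^+ (i * g) = - (th / p%:R) * G.
    by rewrite /G mulr_sumr.
  have -> : \sum_(ce <- s) \sum_(1 <= i < p) - (ce.1 / p%:R) * chi a ^+ (ce.2 + i * g) =
     - (p%:R^-1 * G) * \sum_(ce <- s) ce.1 * chi a ^+ ce.2.
    rewrite mulr_sumr; apply: eq_bigr => ce _; rewrite /G mulr_sumr -sumrN mulr_suml.
    by apply: eq_bigr => i _; rewrite exprD; ring.
  have -> : \sum_(ce <- s) ce.1 * k * chi a ^+ ce.2 = k * \sum_(ce <- s) ce.1 * chi a ^+ ce.2.
    by rewrite mulr_sumr; apply: eq_bigr => ce _; ring.
  by set T := \sum_(ce <- s) _; ring.
Qed.

Lemma primitive_expansion : exists (th : algC) (s : seq (algC * nat)),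
  [/\ 0 < th, forall ce, ce \in s -> ~~ (N %| ce.2)%N,
      \sum_(ce <- s) `|ce.1| <= ((W N)%:R - 1) * th &
      forall a, a != 0 -> (nonpowers (primes N) a)%:R = th + \sum_(ce <- s) ce.1 * chi a ^+ ce.2].
Proof.
have [||th [s [th0 sP sA sE]]] := nonpowers_expansion (primes_uniq N).
- by apply/allP => p; rewrite mem_primes => /and3P [].
- by apply/allP => p; rewrite mem_primes => /and3P [].
by exists th, s; split=> // ce /sP [].
Qed.

Lemma nonpowers_primitive a : a != 0 -> nonpowers (primes N) a -> primitive_element a.
Proof.
move=> a0 /allP np; exists (finField_unit a0) => //.
set u := finField_unit a0; rewrite /generator eq_sym eqEcard subsetT card_finField_unit /=.
have dN : (#[u]%g %| N)%N by rewrite -(card_finField_unit F) order_dvdG // inE.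
rewrite leqNgt; apply/negP => lt.
have q1 : (1 < N %/ #[u]%g)%N by rewrite ltn_divRL // mul1n.
have pp := pdiv_prime q1; have pd := pdiv_dvd (N %/ #[u]%g).
set p := pdiv _ in pp pd.
have pN : (p %| N)%N by apply: dvdn_trans pd _; apply/dvdnP; exists #[u]%g; rewrite mulnC divnK.
have := np p; rewrite mem_primes pp N0 pN => /(_ isT) /negP; apply.
have : (u ^+ (N %/ p) == 1)%g.
  rewrite -order_dvdn dvdn_divRL //.
  by rewrite -(divnK dN) mulnC dvdn_pmul2r // order_gt0.
by move=> /eqP /(congr1 val); rewrite FinRing.val_unitX FinRing.val_unit1 => ->.
Qed.
End Vinogradov.

(** * Primitive pairs *)

Lemma twisted_quotient_power (L : fieldType) (x g f h : L) a b N : (0 < N)%N ->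
  x != 0 -> f != 0 -> x ^+ (a + N) * g ^+ b * f ^+ (b * (N - 1)) = h ^+ N ->
  x ^+ a * (g / f) ^+ b = (h / (x * f ^+ b)) ^+ N.
Proof.
move=> N0 x0 f0 E; rewrite [RHS]expr_div_n -E.
apply: (mulIf (expf_neq0 N (mulf_neq0 x0 (expf_neq0 b f0)))).
rewrite divfK ?expf_neq0 ?mulf_neq0 ?expf_neq0 //.
have fb : f ^+ b ^+ N = f ^+ b * f ^+ (b * (N - 1)).
  by rewrite -exprM -exprD -mulnS subn1 prednK.
by rewrite expr_div_n exprMn fb exprD; field; rewrite expf_neq0.
Qed.

Lemma twisted_root_neq0 (L : fieldType) (x f h : L) b :
  x != 0 -> f != 0 -> h != 0 -> h / (x * f ^+ b) != 0.
Proof. by move=> x0 f0 h0; rewrite mulf_neq0 ?invr_eq0 // mulf_neq0 ?expf_neq0. Qed.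

Lemma root_of_quotient (L : fieldType) (x phi G : L) a b d t : G != 0 ->
  x ^+ (a * t) * phi ^+ (b * t) = G ^+ (d * t) -> (x ^+ a * phi ^+ b / G ^+ d) ^+ t = 1.
Proof. by move=> G0 E; rewrite expr_div_n exprMn -!exprM E divff // expf_neq0. Qed.

Lemma coprime_root_extraction (L : fieldType) (x phi G z : L) a b d u v :
  x != 0 -> phi != 0 -> G != 0 -> z = x ^+ a * phi ^+ b / G ^+ d ->
  (u * b = 1 + v * d)%N ->
  phi = z ^+ u / x ^+ (a * u) * (G ^+ u / phi ^+ v) ^+ d.
Proof.
move=> x0 p0 G0 -> uv; rewrite !expr_div_n exprMn -!exprM [(b * u)%N]mulnC uv.
rewrite exprD expr1 [(d * u)%N]mulnC; field.
by rewrite !expf_neq0.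
Qed.

Section Sieve.
Variables (F : finFieldType) (f1 f2 : {poly F}).
Local Notation N := (#|F|.-1).
Hypotheses (f10 : f1 != 0) (mf2 : f2 \is monic).
Hypothesis nonexc : ~ exceptional (tofrac f1 / tofrac f2).
Hypothesis N1 : (1 < N)%N.

Let lc := lead_coef f1.
Let g1 := lc^-1 *: f1.

Let lc0 : lc != 0. Proof. by rewrite lead_coef_eq0. Qed.
Let mg1 : g1 \is monic. Proof. by rewrite monicE lead_coefZ mulVf. Qed.
Let f1E : f1 = lc%:P * g1. Proof. by rewrite mul_polyC scalerA divff // scale1r. Qed.
Let f20 : f2 != 0 := monic_neq0 mf2.
Let g10 : g1 != 0 := monic_neq0 mg1.

(** If H = X^a f1^b f2^(-b) is an N-th power up to a constant and t = gcd(b, N),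
    then t divides a (compare the multiplicities at 0), and extracting t-th roots
    gives x^a' f^b' = zeta G^d with d = N / t > 1 and b' prime to d; the roots of
    unity of order dividing N lie in F.  By a Bezout relation f is then a
    constant times a power of x times a d-th power. *)
Lemma twisted_not_power a b : ~~ (N %| b)%N -> forall h, h \is monic ->
  'X^(a + N) * g1 ^+ b * f2 ^+ (b * (N - 1)) <> h ^+ N.
Proof.
move=> Nb h mh HE; apply: nonexc.
have N0 : (0 < N)%N := ltnW N1.
have b0 : (0 < b)%N by case: b Nb {HE} => //; rewrite dvdn0.
pose t := gcdn b N; have t0 : (0 < t)%N by rewrite gcdn_gt0 b0.
pose d := (N %/ t)%N; pose b' := (b %/ t)%N.
have dE : (d * t = N)%N by rewrite divnK // dvdn_gcdr.
have bE : (b' * t = b)%N by rewrite divnK // dvdn_gcdl.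
have d1 : (1 < d)%N.
  rewrite ltn_neqAle divn_gt0 // dvdn_leq ?dvdn_gcdr // andbT eq_sym.
  apply: contra Nb => /eqP d1; by rewrite -dE d1 mul1n dvdn_gcdl.
have ta : (t %| a)%N.
  have := congr1 (mup 0) HE; rewrite !mupM ?mulf_neq0 ?expf_neq0 ?polyX_eq0 //.
  rewrite !mup_expn ?polyX_eq0 ?monic_neq0 // -['X]subr0 -polyC0 (mup_XsubCX 1) eqxx muln1.
  move=> E; have := dvdn_mulr (mup 0 h) (dvdn_gcdr b N); rewrite -E.
  rewrite dvdn_addl; last by rewrite -mulnA dvdn_mulr // dvdn_gcdl.
  rewrite dvdn_addl; last by rewrite dvdn_mulr // dvdn_gcdl.
  by rewrite dvdn_addl // dvdn_gcdr.
pose a' := (a %/ t)%N; have aE : (a' * t = a)%N by rewrite divnK.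
pose x := tofrac ('X : {poly F}); pose phi := tofrac g1 / tofrac f2.
have x0 : x != 0 by rewrite tofrac_eq0 polyX_eq0.
have F20 : tofrac f2 != 0 by rewrite tofrac_eq0.
have G10 : tofrac g1 != 0 by rewrite tofrac_eq0.
have phi0 : phi != 0 by apply: mulf_neq0 G10 _; rewrite invr_eq0.
pose G := tofrac h / (x * tofrac f2 ^+ b).
have h0 : tofrac h != 0 by rewrite tofrac_eq0; apply: monic_neq0.
have G0 : G != 0 by exact: twisted_root_neq0 x0 F20 h0.
have E1 : x ^+ a * phi ^+ b = G ^+ N.
  apply: twisted_quotient_power N0 x0 F20 _.
  by have := congr1 (@tofrac _) HE; rewrite !tofracM !tofracXn.
pose z := x ^+ a' * phi ^+ b' / G ^+ d.
have zt : z ^+ t = 1.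
  by apply: root_of_quotient G0 _; rewrite aE bE dE.
have [zeta zE] : exists zeta : F, z = tofrac zeta%:P.
  apply: (@fixed_in_subfield F _ (@tofrac _ \o polyC)).
  rewrite -(prednK (ltnW (finNzRing_gt1 F))) exprS -dE mulnC exprM zt expr1n mulr1 //.
have z0 : zeta != 0.
  apply/eqP => z00; have /eqP := zt; rewrite zE z00 tofrac0 expr0n gtn_eqF // eq_sym.
  by rewrite oner_eq0.
have cop : coprime b' d.
  rewrite /coprime -(@eqn_pmul2r t) // mul1n muln_gcdl bE dE //.
have b'0 : (0 < b')%N by rewrite divn_gt0 // dvdn_leq // dvdn_gcdl.
have [[u v] /= uv] := coprimeP _ b'0 cop.
have uvE : (u * b' = 1 + v * d)%N.
  have lt : (v * d < u * b')%N by rewrite -subn_gt0 uv.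
  by rewrite -uv subnK // ltnW.
exists (- ((a' * u)%N%:Z)), d, (lc * zeta ^+ u), (G ^+ u / phi ^+ v); split => //.
- by rewrite subn1 -dE dvdn_mulr.
- by rewrite mulf_neq0 ?expf_neq0.
have -> : tofrac f1 / tofrac f2 = tofrac lc%:P * phi by rewrite f1E tofracM mulrA.
rewrite {1}(coprime_root_extraction x0 phi0 G0 (esym zE : _ = _) uvE).
by rewrite -exprnN polyCM polyC_exp tofracM tofracXn; ring.
Qed.

Variables (p e : nat).
Hypotheses (pp : prime p) (cardF : #|F| = (p ^ e)%N).
Variables (chi : F -> algC).
Hypothesis chiP : mult_char chi.

Let n := ((size f1).-1 + (size f2).-1)%N.
Definition regular_points := [pred a : F | [&& a != 0, f1.[a] != 0 & f2.[a] != 0]].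
Definition twisted_sum a b := \sum_(x in regular_points) chi (x ^+ a * (f1.[x] / f2.[x]) ^+ b).

Lemma card_irregular : (#|[pred x | root (f1 * f2) x]| <= n)%N.
Proof.
have ff : f1 * f2 != 0 by rewrite mulf_neq0.
have := @max_poly_roots _ (f1 * f2) (enum [pred x | root (f1 * f2) x]) ff.
rewrite enum_uniq -cardE => /(_ _ isT) H.
rewrite -ltnS; apply: leq_trans (H _) _.
  by apply/allP => x; rewrite mem_enum.
by rewrite size_mul // /n (polySpred f10) (polySpred f20) /= addnS.
Qed.

Lemma card_regular : (N - n <= #|regular_points|)%N.
Proof.
rewrite leq_subLR -(cardC1 (0 : F)); apply: leq_trans (leq_add card_irregular (leqnn _)).
rewrite -cardUI; apply: leq_trans (leq_addr _ _); apply/subset_leq_card/subsetP => x.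
rewrite !inE /root hornerM mulf_eq0 => ->.
by case: (f1.[x] == 0); case: (f2.[x] == 0).
Qed.

(** Adding N to the exponent of X and replacing f2^(-b) by f2^(b(N-1)) gives a
    polynomial with the same values at the regular points, up to the constant
    lc^b; its exponents are all positive, so it vanishes at the other points.  The modulus X f1 f2 has
    degree n + 1. *)
Lemma twisted_sum_bound_snd a b : ~~ (N %| b)%N ->
  `|twisted_sum a b| <= n%:R * sqrtC #|F|%:R.
Proof.
move=> Nb; have N0 : (0 < N)%N := ltnW N1.
have b0 : (0 < b)%N by case: b Nb => //; rewrite dvdn0.
pose H := 'X^(a + N) * g1 ^+ b * f2 ^+ (b * (N - 1)).
have HE x : H.[x] = x ^+ (a + N) * g1.[x] ^+ b * f2.[x] ^+ (b * (N - 1)).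
  by rewrite /H !hornerM !horner_exp hornerX.
have mH : H \is monic by rewrite !monicMl ?monic_exp // monicX.
pose r := 'X * g1 * f2.
have r0 : r != 0 by rewrite !mulf_neq0 // polyX_eq0.
have N10 : (0 < N - 1)%N by rewrite subn_gt0.
have sr : (size r <= n.+2)%N.
  rewrite /r -mulrA size_monicM ?monicX ?mulf_neq0 // size_polyX size_monicM //.
  by rewrite /g1 size_scale ?invr_eq0 // /n (polySpred f10) (polySpred f20) /= addnS.
pose t := (a + N + b + b * (N - 1))%N.
have Hr : H %| r ^+ t.
  rewrite /H /r !exprMn; apply: dvdp_mul; first apply: dvdp_mul; apply: dvdp_exp2l.
  - by rewrite /t -!addnA leq_add2l leq_addr.
  - by rewrite /t addnAC leq_addl.
  - by rewrite /t leq_addl.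
have := weil_bound pp cardF chiP mH (twisted_not_power Nb) Hr r0 sr.
suff -> : twisted_sum a b = chi (lc ^+ b) * \sum_x chi H.[x].
  by rewrite normrM (norm_mult_char chiP) ?mul1r // expf_neq0.
rewrite mulr_sumr /twisted_sum big_mkcond /=; apply: eq_bigr => x _.
case: (chiP) => cM c0 _ _; rewrite -cM HE.
have f1x : f1.[x] = lc * g1.[x] by rewrite {1}f1E hornerM hornerC.
case: ifP => [/and3P [x0 fx1 fx2]|].
  congr chi; rewrite f1x exprD expf_card1 // mulr1.
  have -> : f2.[x] ^+ (b * (N - 1)) = (f2.[x] ^+ b)^-1.
    apply: (mulfI (expf_neq0 b fx2)); rewrite -exprD divff ?expf_neq0 //.
    by rewrite -mulnS subn1 prednK // mulnC exprM expf_card1 // expr1n.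
  by rewrite expr_div_n exprMn; ring.
move/negbT; rewrite !inE !negb_and !negbK f1x mulf_eq0 (negPf lc0) /=.
by case/or3P => /eqP ->; rewrite expr0n gtn_eqF ?addn_gt0 ?N0 ?orbT ?muln_gt0 ?b0 //=
  ?(mul0r, mulr0) c0.
Qed.

(** The full character sum over the units is 0, and at most n units are not
    regular. *)
Lemma twisted_sum_bound_fst a b : (N %| b)%N -> ~~ (N %| a)%N ->
  `|twisted_sum a b| <= n%:R.
Proof.
move=> Nb Na; have N0 : (0 < N)%N := ltnW N1.
have [|y y0 ya] := @exists_nontorsion F (a %% N).
  by rewrite lt0n -/(dvdn N a) Na ltn_pmod.
have {}ya : y ^+ a != 1.
  by rewrite (divn_eq a N) mulnC exprD exprM expf_card1 // expr1n mul1r.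
case: (chiP) => cM c0 c1 ci.
have S0 : \sum_(x | x != 0) chi (x ^+ a) = 0.
  have ne : chi (y ^+ a) != 1 by rewrite -c1 (inj_eq ci).
  set S := \sum_(_ | _) _.
  have /eqP : S = chi (y ^+ a) * S.
    rewrite {1}/S (reindex (fun x => y * x)) /=.
      rewrite mulr_sumr; apply: eq_big => [x|x _]; last by rewrite exprMn cM.
      by rewrite mulf_eq0 negb_or y0.
    by exists (fun x => y^-1 * x) => x _; [rewrite mulKf|rewrite mulVKf].
  rewrite -subr_eq0 -{1}[S]mul1r -mulrBl mulf_eq0 subr_eq0 eq_sym (negPf ne) /=.
  by move/eqP.
have TE : twisted_sum a b = \sum_(x in regular_points) chi (x ^+ a).
  apply: eq_bigr => x /and3P [x0 fx1 fx2]; rewrite -(divnK Nb) mulnC exprM.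
  by rewrite expf_card1 ?mulf_neq0 ?invr_eq0 // expr1n mulr1.
have : twisted_sum a b + \sum_(x | (x != 0) && (x \notin regular_points)) chi (x ^+ a) = 0.
  rewrite TE; apply: etrans S0; rewrite [RHS](bigID (mem regular_points)) /=; congr (_ + _).
  by apply: eq_bigl => x; rewrite !inE; case: (x != 0).
move/eqP; rewrite addr_eq0 => /eqP ->; rewrite normrN.
apply: le_trans (ler_norm_sum _ _ _) _.
apply: (@le_trans _ _ (\sum_(x | (x != 0) && (x \notin regular_points)) 1)).
  by apply: ler_sum => x _; apply: norm_mult_char_le1.
rewrite sumr_const ler_nat; apply: leq_trans card_irregular.
apply/subset_leq_card/subsetP => x; rewrite !inE => /andP [x0].
by rewrite inE x0 /= negb_and !negbK /root hornerM mulf_eq0.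
Qed.

(** If there is no primitive pair, the expansion of the product of the two
    indicators sums to 0 over the regular points, so th^2 times their number is
    at most th^2 (W^2 - 1) n sqrt q; but at least q - 1 - n points are regular. *)
Lemma primitive_pair_exists :
  n%:R * (W N)%:R ^+ 2 < sqrtC #|F|%:R :> algC -> (2 <= n)%N ->
  exists a, [/\ a \in regular_points, primitive_element a &
                primitive_element (f1.[a] / f2.[a])].
Proof.
move=> big n2; have N0 : (0 < N)%N := ltnW N1.
have [th [s [th0 sP sA sE]]] := primitive_expansion chiP.
pose ps := primes N.
case: (boolP [exists a in regular_points, nonpowers ps a && nonpowers ps (f1.[a] / f2.[a])]).
  case/exists_inP => a ra /andP [pa pf]; exists a; split=> //.
    by apply: nonpowers_primitive pa; case/and3P: ra.
  apply: nonpowers_primitive pf; case/and3P: ra => _ h1 h2.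
  by rewrite mulf_neq0 ?invr_eq0.
rewrite negb_exists_in => /forall_inP hno; exfalso.
pose s' := (th, 0%N) :: s.
have sE' a : a != 0 -> (nonpowers ps a)%:R = \sum_(x <- s') x.1 * chi (a ^+ x.2).
  move=> a0; rewrite sE // big_cons /= expr0; case: (chiP) => _ _ -> _; rewrite mulr1.
  by congr (_ + _); apply: eq_bigr => x _; rewrite mult_charX.
have zero : \sum_(x <- s') \sum_(y <- s') x.1 * y.1 * twisted_sum x.2 y.2 = 0.
  transitivity (\sum_(a in regular_points)
     (nonpowers ps a)%:R * (nonpowers ps (f1.[a] / f2.[a]))%:R : algC); last first.
    rewrite big1 // => a ra; have := hno a ra; rewrite -natrM mulnb.
    by move/negPf ->.
  transitivity (\sum_(x <- s') \sum_(y <- s') \sum_(a in regular_points)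
     (x.1 * chi (a ^+ x.2)) * (y.1 * chi ((f1.[a] / f2.[a]) ^+ y.2))).
    apply: eq_bigr => x _; apply: eq_bigr => y _; rewrite /twisted_sum mulr_sumr.
    by apply: eq_bigr => a _; case: (chiP) => -> _ _ _; ring.
  under eq_bigr do rewrite exchange_big /=.
  rewrite exchange_big /=; apply: eq_bigr => a /and3P [a0 h1 h2].
  rewrite !sE' ?mulf_neq0 ?invr_eq0 // mulr_suml; apply: eq_bigr => x _.
  by rewrite mulr_sumr.
set q := #|F| in big *.
have q0 : (0 : algC) < sqrtC q%:R by rewrite sqrtC_gt0 ltr0n (ltnW (finNzRing_gt1 F)).
pose B : algC := n%:R * sqrtC q%:R.
have q1 : (1 : algC) <= sqrtC q%:R by rewrite -[leLHS]sqrtC1 ler_sqrtC ?nnegrE ?ler01 ?ler0n //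
    ler1n (ltnW (finNzRing_gt1 F)).
have bound a b : (~~ (N %| a) || ~~ (N %| b))%N -> `|twisted_sum a b| <= B.
  case: (boolP (N %| b)%N) => [Nb|Nb _]; last exact: twisted_sum_bound_snd.
  rewrite orbF => Na; apply: le_trans (twisted_sum_bound_fst Nb Na) _.
  by rewrite ler_peMr ?ler0n.
have thw : 0 <= th := ltW th0.
pose A := \sum_(x <- s) `|x.1|.
have A0 : 0 <= A by apply: sumr_ge0.
have R1 : `|\sum_(y <- s) th * y.1 * twisted_sum 0 y.2| <= th * A * B.
  apply: le_trans (ler_norm_sum _ _ _) _; rewrite /A mulr_sumr mulr_suml.
  rewrite big_seq [leRHS]big_seq; apply: ler_sum => y ys.
  by rewrite !normrM (gtr0_norm th0) ler_wpM2l ?mulr_ge0 // bound // (sP y ys) orbT.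
have R2 : `|\sum_(x <- s) \sum_(y <- s') x.1 * y.1 * twisted_sum x.2 y.2| <= A * (th + A) * B.
  apply: le_trans (ler_norm_sum _ _ _) _; rewrite -mulrA mulr_suml.
  rewrite big_seq [leRHS]big_seq; apply: ler_sum => x xs.
  apply: le_trans (ler_norm_sum _ _ _) _.
  have -> : th + A = \sum_(y <- s') `|y.1| by rewrite big_cons /= (gtr0_norm th0).
  rewrite mulr_suml mulr_sumr; apply: ler_sum => y _.
  by rewrite !normrM mulrA ler_wpM2l ?mulr_ge0 // bound // (sP x xs).
have main : th * th * #|regular_points|%:R <= (th * A + A * (th + A)) * B.
  have T0 : twisted_sum 0 0 = #|regular_points|%:R.
    rewrite /twisted_sum -sum1_card natr_sum; apply: eq_bigr => x _.
    by rewrite !expr0 mulr1; case: (chiP).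
  move: zero; rewrite [LHS]big_cons [X in X + _]big_cons /= T0 -addrA.
  move/eqP; rewrite addr_eq0 => /eqP E.
  rewrite -[leLHS]ger0_norm ?mulr_ge0 ?ler0n // E normrN mulrDl.
  by apply: le_trans (ler_normD _ _) _; apply: lerD.
have hA : (th * A + A * (th + A)) <= th * th * ((W N)%:R ^+ 2 - 1).
  have W1 : 0 <= (W N)%:R - 1 :> algC by rewrite subr_ge0 ler1n expn_gt0.
  have -> : th * th * ((W N)%:R ^+ 2 - 1) = th * (((W N)%:R - 1) * th) +
      (((W N)%:R - 1) * th) * (th + ((W N)%:R - 1) * th) :> algC by ring.
  apply: lerD; first by rewrite ler_pM2l.
  by apply: ler_pM => //; [rewrite addr_ge0 // ltW|rewrite lerD2l].
have : #|regular_points|%:R <= ((W N)%:R ^+ 2 - 1) * B.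
  rewrite -(@ler_pM2l _ (th * th)) ?mulr_gt0 // mulrA; apply: le_trans main _.
  by rewrite ler_wpM2r // mulr_ge0 ?ler0n // ltW.
have : (N - n)%:R <= #|regular_points|%:R :> algC by rewrite ler_nat card_regular.
have : N%:R - n%:R <= (N - n)%:R :> algC.
  by rewrite lerBlDr -natrD ler_nat addnC -leq_subLR.
move=> h1 h2 h3; have := le_trans h1 (le_trans h2 h3).
have -> : (N%:R : algC) = sqrtC q%:R ^+ 2 - 1.
  by rewrite sqrtCK -subn1 natrB // (ltnW (finNzRing_gt1 F)).
have sreal : sqrtC q%:R \is Num.real := gtr0_real q0.
apply/negP; rewrite -real_ltNge ?(rpredM, rpredB, rpredX, realn, real1, sreal) //.
have h4 : n%:R * (W N)%:R ^+ 2 * sqrtC q%:R < sqrtC q%:R ^+ 2 :> algC.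
  by rewrite [ltRHS]expr2 ltr_pM2r.
have h5 : n%:R + 1 <= B.
  have q2 : 2%:R <= sqrtC q%:R :> algC.
    apply: le_trans (ltW big); rewrite -natrX -natrM ler_nat.
    by apply: leq_trans n2 _; rewrite leq_pmulr // expn_gt0 expn_gt0.
  apply: (@le_trans _ _ (n%:R * 2%:R)); last by rewrite ler_pM2l // ltr0n ltnW.
  by rewrite natr1 -natrM ler_nat muln2 -addnn -addn1 leq_add2l ltnW.
rewrite mulrBl mul1r.
have -> : (W N)%:R ^+ 2 * B = n%:R * (W N)%:R ^+ 2 * sqrtC q%:R by rewrite /B; ring.
rewrite -subr_gt0.
have -> : sqrtC q%:R ^+ 2 - 1 - n%:R - (n%:R * (W N)%:R ^+ 2 * sqrtC q%:R - B) =
  (sqrtC q%:R ^+ 2 - n%:R * (W N)%:R ^+ 2 * sqrtC q%:R) + (B - (n%:R + 1)) by ring.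
by rewrite ltr_wpDr ?subr_ge0 // subr_gt0.
Qed.

End Sieve.

(** * The two claims *)

Lemma prod_primes_le m : (0 < m)%N -> (\prod_(p <- primes m) p <= m)%N.
Proof.
move=> m0; rewrite {2}(prod_prime_decomp m0) prime_decompE big_map /=.
rewrite big_seq [leqRHS]big_seq; apply: leq_prod => p pm.
by rewrite -{1}[p]expn1 leq_pexp2l ?logn_gt0 // prime_gt0 //; move: pm; rewrite mem_primes => /andP [].
Qed.

(** A prime p >= b contributes at most p to the left side, and at most b primes
    are smaller than b. *)
Lemma expn_omega_le b m : (0 < b)%N -> (0 < m)%N -> (b ^ omega m <= b ^ b * m)%N.
Proof.
move=> b0 m0.
have step s : all prime s -> (b ^ size s <= b ^ (count (gtn b) s) * \prod_(p <- s) p)%N.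
  elim: s => [|p s IH] /=; first by rewrite big_nil.
  case/andP => pp /IH {}IH; rewrite big_cons expnS expnD mulnACA.
  apply: leq_mul IH; case: ltnP => pb /=.
    by rewrite expn1 leq_pmulr // prime_gt0.
  by rewrite expn0 mul1n.
have small : (count (gtn b) (primes m) <= b)%N.
  rewrite -size_filter -[leqRHS](size_iota 0); apply: uniq_leq_size.
    by rewrite filter_uniq ?primes_uniq.
  by move=> p; rewrite mem_filter mem_iota => /andP [].
apply: leq_trans (step (primes m) _) _.
  by apply/allP => p; rewrite mem_primes => /and3P [].
by apply: leq_mul; [rewrite leq_pexp2l|apply: prod_primes_le].
Qed.

Lemma in_Q_of_nat_ineq n q : (2 <= n)%N -> prime_power q ->
  ((n * W (q - 1) ^ 2) ^ 2 < q)%N -> in_Q n q.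
Proof.
move=> n2 qpp ineq; split=> // F cF f [nex [f1 [f2 [[fE f10 mf2 cop] deg _]]]].
have [p [k [pp [k0 qE]]]] := qpp.
have cardF : #|F| = (p ^ k)%N by rewrite cF.
have W0 : (0 < W (q - 1))%N by rewrite /W expn_gt0.
have q4 : (4 < q)%N.
  apply: leq_ltn_trans ineq; rewrite -[4%N]/(2 ^ 2)%N leq_exp2r //.
  by apply: leq_trans n2 _; rewrite leq_pmulr // expn_gt0 W0.
have N1 : (1 < #|F|.-1)%N by rewrite cF; lia.
have [chi chiP] := mult_char_exists F.
rewrite fE in nex.
have [||a [ra pa pb]] := primitive_pair_exists f10 mf2 nex N1 pp cardF chiP.
- rewrite deg -subn1 cF -(@ltr_pXn2r _ 2) ?nnegrE ?sqrtC_ge0 ?mulr_ge0 ?exprn_ge0 ?ler0n //.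
  by rewrite sqrtCK -!natrX -natrM -natrX ltr_nat.
- by rewrite deg.
exists a, (f1.[a] / f2.[a]); split=> //.
exists f1, f2; split=> //; by case/and3P: ra.
Qed.

Theorem theorem1p1 (R : realType) :
  (forall n q : nat, (2 <= n)%N -> prime_power q ->
     n%:R * (W (q - 1))%:R ^+ 2 < Num.sqrt (q%:R : R) ->
     in_Q n q)
  /\
  (forall n : nat, (2 <= n)%N ->
     exists2 C : R, 0 < C &
       forall q : nat, prime_power q -> C < q%:R -> in_Q n q).
Proof.
split=> [n q n2 qpp ineq|n n2].
  apply: in_Q_of_nat_ineq => //; rewrite -(ltr_nat R).
  rewrite -[ltRHS]sqr_sqrtr ?ler0n // natrX natrM natrX.
  by rewrite ltr_pXn2r ?nnegrE ?sqrtr_ge0 // mulr_ge0 ?exprn_ge0 ?ler0n.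
have [K KP] : exists K, forall m, (0 < m)%N -> (256 ^ omega m <= K * m)%N.
  by exists (256 ^ 256)%N => m; apply: expn_omega_le.
(* If (n W^2)^2 >= q, squaring gives q^2 <= n^4 256^omega(q-1) <= n^4 K (q-1),
   so q < n^4 K; the extra 2 gives q > 1. *)
exists (n ^ 4 * K).+2%:R; first by rewrite ltr0n.
move=> q qpp; rewrite ltr_nat => qC; apply: in_Q_of_nat_ineq => //.
have q1 : (0 < q - 1)%N by rewrite subn_gt0; apply: leq_ltn_trans qC.
have W8 : (((n * W (q - 1) ^ 2) ^ 2) ^ 2 = n ^ 4 * 256 ^ omega (q - 1))%N.
  have -> : (256 ^ omega (q - 1) = W (q - 1) ^ 8)%N by rewrite /W -expnM mulnC expnM.
  by move: (W _) => w; ring.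
have q0 : (0 < q)%N by apply: leq_trans q1 (leq_subr _ _).
rewrite ltnNge -leq_sqr W8 -ltnNge; apply: leq_ltn_trans (_ : n ^ 4 * K * q < _)%N.
  rewrite -mulnA leq_mul2l (leq_trans (KP _ q1)) ?orbT // leq_mul2l leq_subr orbT //.
by rewrite -mulnn ltn_pmul2r //; apply: leq_trans (leqnSn _) (ltnW qC).
Qed.
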